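(* Let $n\ge 2$ and $k\in\{1,\dots,n-1\}$. The data $(\mathcal X_k,\gamma,\varphi_i,\varepsilon_i,e_i,f)$ (with $i$ ranging over $\mathbb Z/n\mathbb Z$) defined below form a decorated geometric crystal of type $A_{n-1}^{(1)}$.
   Context: Notation: $[i,j]=\{m\in\mathbb Z: i\le m\le j\}$, $[n]=[1,n]$. Points $M$ of the Grassmannian $\mathrm{Gr}(k,n)$ of $k$-dimensional subspaces of $\mathbb C^n$ are represented as column spans of full-rank $n\times k$ matrices; for a $k$-subset $J\subset[n]$, the Plücker coordinate $P_J(M)$ is the maximal minor of such a matrix using the rows in $J$ in increasing order (defined up to a common scalar). Conventions: for any finite set $I$ of integers, $P_I(M):=P_{I'}(M)$ where $I'\subset[n]$ is the set of residues modulo $n$ (taken in $[n]$) of the elements of $I$, and $P_{I'}(M)=0$ if $I'$ does not have exactly $k$ elements. $\mathrm{GL}_n(\mathbb C)$ acts on $\mathrm{Gr}(k,n)$ by left multiplication of representing matrices. $E_{ij}$ denotes an $n\times n$ matrix unit; $x_i(a)=\mathrm{Id}+aE_{i,i+1}$ for $i\in[n-1]$ and $x_0(a)=\mathrm{Id}+aE_{n1}$. Let $\mathcal X_k=\mathrm{Gr}(k,n)\times\mathbb C^\times$, with points $(M,t)$. For $i\in\mathbb Z/n\mathbb Z$ (represented in $\{0,\dots,n-1\}$; $\delta_{i,a}$ means $1$ if $i\equiv a\pmod n$, else $0$) define: - $\gamma(M,t)=(\gamma_1,\dots,\gamma_n)$ with $\gamma_i=P_{[i-k+1,i]}(M)/P_{[i-k,i-1]}(M)$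 for $1\le i\le k$ and $\gamma_i=t\,P_{[i-k+1,i]}(M)/P_{[i-k,i-1]}(M)$ for $k+1\le i\le n$; - $\varphi_i(M,t)=t^{-\delta_{i,0}}\dfrac{P_{[i-k+1,i-1]\cup\{i+1\}}(M)}{P_{[i-k+1,i]}(M)}$, $\quad\varepsilon_i(M,t)=t^{-\delta_{i,k}}\dfrac{P_{[i-k+1,i-1]\cup\{i+1\}}(M)\,P_{[i-k+1,i]}(M)}{P_{[i-k,i-1]}(M)\,P_{[i-k+2,i+1]}(M)}$; - $e_i^c(M,t)=(M',t)$ where $M'=x_i\big(\frac{c-1}{\varphi_i(M,t)}\big)\cdot M$ if $i\ne0$ and $M'=x_0\big(\frac{(-1)^{k-1}}{t}\cdot\frac{c-1}{\varphi_0(M,t)}\big)\cdot M$ if $i=0$; - $f(M,t)=\sum_{i\in[n],\,i\ne k}\dfrac{P_{\{i-k\}\cup[i-k+2,i]}(M)}{P_{[i-k+1,i]}(M)}+t\,\dfrac{P_{[2,k]\cup\{n\}}(M)}{P_{[1,k]}(M)}$. Definitions. A geometric pre-crystal of type $A_{n-1}^{(1)}$ consists of an irreducible complex algebraic variety $X$, a rational map $\gamma:X\to(\mathbb C^\times)^n$, for each $i\in\mathbb Z/n\mathbb Z$ rational functions $\varphi_i,\varepsilon_i:X\to\mathbb C^\times$ not identically zero, and for each $i$ a rational unital action $e_i:\mathbb C^\times\times X\to X$, $(c,x)\mapsto e_i^c(x)$ (unital: $e_i^1(x)$ is defined and equals $x$ for all $x$; action: $e_i^{c_1}e_i^{c_2}=e_i^{c_1c_2}$),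 such that: (1) $\varepsilon_i(x)=\varphi_i(x)\alpha_i(\gamma(x))$ where $\alpha_i(z_1,\dots,z_n)=z_i/z_{i+1}$ (indices mod $n$); (2) $\gamma(e_i^c(x))=\alpha_i^\vee(c)\gamma(x)$ (componentwise product), where $\alpha_i^\vee(c)$ has $c$ in component $i$, $c^{-1}$ in component $i+1$ (mod $n$), and $1$ elsewhere; (3) $\varphi_i(e_i^c(x))=c^{-1}\varphi_i(x)$ and $\varepsilon_i(e_i^c(x))=c\,\varepsilon_i(x)$. It is a geometric crystal if moreover, when $n\ge3$, for all $i,j\in\mathbb Z/n\mathbb Z$ and $c_1,c_2\in\mathbb C^\times$: $e_i^{c_1}e_j^{c_2}=e_j^{c_2}e_i^{c_1}$ if $|i-j|>1$, and $e_i^{c_1}e_j^{c_1c_2}e_i^{c_2}=e_j^{c_2}e_i^{c_1c_2}e_j^{c_1}$ if $|i-j|=1$ (distance taken in $\mathbb Z/n\mathbb Z$); for $n=2$ no such relation is required. A decorated geometric crystal is a geometric crystal with a rational function $f:X\to\mathbb C^\times$ (the decoration) such that $f(e_i^c(x))=f(x)+\frac{c-1}{\varphi_i(x)}+\frac{c^{-1}-1}{\varepsilon_i(x)}$ for all $x$ and all $i$. *)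

(* Defs.v *)
From HB Require Import structures.
From mathcomp Require Import all_boot all_order all_algebra.
From mathcomp Require Import mpoly.

Set Implicit Arguments.
Unset Strict Implicit.
Unset Printing Implicit Defensive.
Import GRing.Theory.
Local Open Scope ring_scope.

(** * Algebraic varieties

  A variety over [K] is given by a set of points with finitely many affine
  charts, each identifying a subset of the points with a Zariski closed subset
  of an affine space [K^m]. *)

Record atlas (K : fieldType) (X : Type) := Atlas {
  chart_idx : finType;
  chart_dim : chart_idx -> nat;
  chart_dom : chart_idx -> X -> Prop;
  (* only the values on [chart_dom a] are relevant *)
  chart : forall a : chart_idx, X -> 'rV[K]_(chart_dim a) }.

Definition peval (K : fieldType) (m : nat) (p : {mpoly K[m]}) (v : 'rV[K]_m) : K :=
  p.@[fun j => v 0 j].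

Definition algebraic_set (K : fieldType) (m : nat) (V : 'rV[K]_m -> Prop) : Prop :=
  exists S : {mpoly K[m]} -> Prop,
    forall v, V v <-> (forall p, S p -> peval p v = 0).

Definition zclosed (K : fieldType) (X : Type) (A : atlas K X) (Z : X -> Prop) : Prop :=
  forall a : chart_idx A, exists S : {mpoly K[chart_dim a]} -> Prop,
    forall x, chart_dom a x ->
      (Z x <-> (forall p, S p -> peval p (chart a x) = 0)).

Definition zopen (K : fieldType) (X : Type) (A : atlas K X) (U : X -> Prop) : Prop :=
  zclosed A (fun x => ~ U x).

(* [g] restricts to a regular function on the open set [U]: locally it is a
   quotient of polynomials in the coordinates of some chart. *)
Definition regular (K : fieldType) (X : Type) (A : atlas K X)
    (U : X -> Prop) (g : X -> K) : Prop :=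
  forall x, U x ->
  exists (a : chart_idx A) (p q : {mpoly K[chart_dim a]}),
    [/\ chart_dom a x,
        peval q (chart a x) != 0
      & forall y, U y -> chart_dom a y -> peval q (chart a y) != 0 ->
          g y = peval p (chart a y) / peval q (chart a y)].

Record is_variety (K : fieldType) (X : Type) (A : atlas K X) : Prop := IsVariety {
  var_cover : forall x, exists a : chart_idx A, chart_dom a x;
  var_inj : forall (a : chart_idx A) x y,
    chart_dom a x -> chart_dom a y -> chart a x = chart a y -> x = y;
  var_affine : forall a : chart_idx A,
    algebraic_set (fun v => exists2 x, chart_dom a x & chart a x = v);
  var_dom_open : forall a : chart_idx A, zopen A (chart_dom a);
  var_transition : forall (a b : chart_idx A) (j : 'I_(chart_dim b)) x,
    chart_dom a x -> chart_dom b x ->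
    exists p q : {mpoly K[chart_dim a]},
      peval q (chart a x) != 0 /\
      forall y, chart_dom a y -> chart_dom b y -> peval q (chart a y) != 0 ->
        chart b y 0 j = peval p (chart a y) / peval q (chart a y);
  (* the diagonal is closed in the product of any two charts *)
  var_separated : forall a b : chart_idx A,
    algebraic_set (fun w => exists x,
      [/\ chart_dom a x, chart_dom b x & w = row_mx (chart a x) (chart b x)]) }.

Definition irreducible_space (K : fieldType) (X : Type) (A : atlas K X) : Prop :=
  (exists x : X, True) /\
  forall Z1 Z2 : X -> Prop, zclosed A Z1 -> zclosed A Z2 ->
    (forall x, Z1 x \/ Z2 x) -> (forall x, Z1 x) \/ (forall x, Z2 x).

Definition prod_atlas (K : fieldType) (X Y : Type) (A : atlas K X) (B : atlas K Y) :
    atlas K (X * Y) :=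
  @Atlas K (X * Y)%type
    (chart_idx A * chart_idx B)%type
    (fun ab => chart_dim ab.1 + chart_dim ab.2)%N
    (fun ab xy => chart_dom ab.1 xy.1 /\ chart_dom ab.2 xy.2)
    (fun ab xy => row_mx (chart ab.1 xy.1) (chart ab.2 xy.2)).

(** ** Rational maps

  A rational map from an irreducible variety is represented by a partial
  function (valued in [option]) that is a morphism on a nonempty, hence dense,
  open domain.  The domain need not be the largest possible one. *)

Definition preim_opt (X Y : Type) (F : X -> option Y) (V : Y -> Prop) : X -> Prop :=
  fun x => exists2 y, F x = Some y & V y.

Definition is_rational (K : fieldType) (X Y : Type) (A : atlas K X) (B : atlas K Y)
    (F : X -> option Y) : Prop :=
  (exists x y, F x = Some y) /\
  forall V : Y -> Prop, zopen B V ->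
    zopen A (preim_opt F V) /\
    forall g : Y -> K, regular B V g ->
      regular A (preim_opt F V) (fun x => oapp g 0 (F x)).

Definition generically (K : fieldType) (X : Type) (A : atlas K X) (P : X -> Prop) : Prop :=
  exists U : X -> Prop,
    [/\ zopen A U, exists x, U x & forall x, U x -> P x].

(* Equality of rational maps; in particular both sides, which may be composites,
   are required to be defined on a nonempty open set. *)
Definition rat_eq (K : fieldType) (X Y : Type) (A : atlas K X)
    (F G : X -> option Y) : Prop :=
  generically A (fun x => exists2 y, F x = Some y & G x = Some y).

(* The rational map represented by [F] is defined at [x], with value [y]:
   some representative of it is. *)
Definition rat_value (K : fieldType) (X Y : Type) (A : atlas K X) (B : atlas K Y)
    (F : X -> option Y) (x : X) (y : Y) : Prop :=
  exists G : X -> option Y, [/\ is_rational A B G, rat_eq A F G & G x = Some y].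

(** ** Tori *)

Definition Gm (K : fieldType) : Type := {c : K | c != 0}.

Definition to_Gm (K : fieldType) (a : K) : option (Gm K) := insub a.

Definition gm1 (K : fieldType) : Gm K := exist _ 1 (oner_neq0 K).

Definition gm_mul (K : fieldType) (c d : Gm K) : Gm K :=
  exist _ (val c * val d) (mulf_neq0 (valP c) (valP d)).

Definition Gm_atlas (K : fieldType) : atlas K (Gm K) :=
  @Atlas K (Gm K) unit (fun _ => 2) (fun _ _ => True)
    (fun _ c => \row_(j < 2) (if j == 0 then val c else (val c)^-1)).

(* Components are indexed by residues modulo [n]: the ordinal [0] stands for the
   component [n]. *)
Definition torus (K : fieldType) (n : nat) : Type :=
  {z : 'rV[K]_n | [forall i, z 0 i != 0]}.

Definition torus_atlas (K : fieldType) (n : nat) : atlas K (torus K n) :=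
  @Atlas K (torus K n) unit (fun _ => n + n)%N (fun _ _ => True)
    (fun _ z => row_mx (val z) (map_mx GRing.inv (val z))).

(** * Geometric crystals of type A_(n-1)^(1)

  The index set Z/nZ is ['I_n], with successor [ordS]. *)

Section Crystals.
Variables (K : fieldType) (n : nat) (X : Type) (A : atlas K X).

Definition alpha (i : 'I_n) (z : torus K n) : K := val z 0 i / val z 0 (ordS i).

Definition alpha_vee (i : 'I_n) (c : Gm K) (j : 'I_n) : K :=
  if j == i then val c else if j == ordS i then (val c)^-1 else 1.

Definition adjacent (i j : 'I_n) : bool := (j == ordS i) || (i == ordS j).

Record rational_unital_action (e : Gm K -> X -> option X) : Prop := RationalUnitalAction {
  act_rational : is_rational (prod_atlas (Gm_atlas K) A) A (fun cx => e cx.1 cx.2);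
  act_unital : forall x, rat_value A A (e (gm1 K)) x x;
  act_mul : forall c1 c2,
    rat_eq A (fun x => obind (e c1) (e c2 x)) (e (gm_mul c1 c2)) }.

Variables (gamma : X -> option (torus K n)) (phi eps : 'I_n -> X -> option (Gm K))
          (e : 'I_n -> Gm K -> X -> option X).

Record geometric_precrystal : Prop := GeometricPrecrystal {
  gpc_variety : is_variety A;
  gpc_irreducible : irreducible_space A;
  gpc_gamma : is_rational A (torus_atlas K n) gamma;
  (* being valued in [Gm], these are not identically zero *)
  gpc_phi : forall i, is_rational A (Gm_atlas K) (phi i);
  gpc_eps : forall i, is_rational A (Gm_atlas K) (eps i);
  gpc_act : forall i, rational_unital_action (e i);
  gpc_eps_phi : forall i, generically A (fun x => exists u v z,
    [/\ eps i x = Some u, phi i x = Some v, gamma x = Some z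
      & val u = val v * alpha i z]);
  gpc_gamma_e : forall i c, generically A (fun x => exists y z z',
    [/\ e i c x = Some y, gamma x = Some z, gamma y = Some z'
      & forall j, val z' 0 j = alpha_vee i c j * val z 0 j]);
  gpc_phi_e : forall i c, generically A (fun x => exists y v v',
    [/\ e i c x = Some y, phi i x = Some v, phi i y = Some v'
      & val v' = (val c)^-1 * val v]);
  gpc_eps_e : forall i c, generically A (fun x => exists y u u',
    [/\ e i c x = Some y, eps i x = Some u, eps i y = Some u'
      & val u' = val c * val u]) }.

Record geometric_crystal : Prop := GeometricCrystal {
  gc_precrystal : geometric_precrystal;
  gc_commute : (3 <= n)%N -> forall (i j : 'I_n) (c1 c2 : Gm K),
    i != j -> ~~ adjacent i j ->
    rat_eq A (fun x => obind (e i c1) (e j c2 x))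
             (fun x => obind (e j c2) (e i c1 x));
  gc_braid : (3 <= n)%N -> forall (i j : 'I_n) (c1 c2 : Gm K),
    adjacent i j ->
    rat_eq A
      (fun x => obind (e i c1) (obind (e j (gm_mul c1 c2)) (e i c2 x)))
      (fun x => obind (e j c2) (obind (e i (gm_mul c1 c2)) (e j c1 x))) }.

Record decorated_geometric_crystal (f : X -> option (Gm K)) : Prop :=
    DecoratedGeometricCrystal {
  dgc_crystal : geometric_crystal;
  dgc_rational : is_rational A (Gm_atlas K) f;
  dgc_decoration : forall i c, generically A (fun x => exists y u v w w',
    [/\ e i c x = Some y, eps i x = Some u /\ phi i x = Some v,
        f x = Some w, f y = Some w'
      & val w' = val w + (val c - 1) / val v + ((val c)^-1 - 1) / val u]) }.

End Crystals.

(** * The Grassmannian *)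

Definition Gr (K : fieldType) (k n : nat) : Type :=
  {V : {vspace 'cV[K]_n} | \dim V == k}.

Section Grassmannian.
Variables (K : fieldType) (k n : nat).

(* A matrix with column span [M].  Plücker coordinates depend on this choice by
   a common scalar only. *)
Definition gr_mx (M : Gr K k n) : 'M[K]_(n, k) :=
  \matrix_(r < n, j < k) (vbasis (val M))`_j r 0.

(* The rows of [B] in [J], in increasing order ([0] if [J] does not have [k]
   elements).  The ordinal [r] is the index of the row numbered [r + 1]. *)
Definition rows_mx (B : 'M[K]_(n, k)) (J : {set 'I_n}) : 'M[K]_k :=
  match #|J| =P k with
  | ReflectT eqJ => rowsub (fun a : 'I_k => enum_val (cast_ord (esym eqJ) a)) B
  | ReflectF _ => 0
  end.

Definition maxminor (B : 'M[K]_(n, k)) (J : {set 'I_n}) : K :=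
  if #|J| == k then \det (rows_mx B J) else 0.

Definition residues (I : seq int) : {set 'I_n} :=
  [set r : 'I_n | has (fun m : int => (r.+1%:Z == m %[mod n%:Z])%Z) I].

Definition plucker (I : seq int) (M : Gr K k n) : K :=
  maxminor (gr_mx M) (residues I).

(* The chart at [J] sends [M] to its representing matrix whose rows in [J] form
   the identity. *)
Definition Gr_atlas : atlas K (Gr K k n) :=
  @Atlas K (Gr K k n) {set 'I_n} (fun _ => n * k)%N
    (fun J M => maxminor (gr_mx M) J != 0)
    (fun J M => mxvec (gr_mx M *m invmx (rows_mx (gr_mx M) J))).

(* Meaningful for invertible [g], which preserves dimensions. *)
Definition gr_act (g : 'M[K]_n) (M : Gr K k n) : Gr K k n :=
  insubd M (linfun (mulmx g) @: val M)%VS.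

Lemma gr_actE (g : 'M[K]_n) (M : Gr K k n) :
  g \in unitmx -> val (gr_act g M) = (linfun (mulmx g) @: val M)%VS.
Proof.
move=> gu; rewrite /gr_act val_insubd limg_dim_eq; first by rewrite (valP M).
apply/eqP; rewrite -subv0; apply/subvP=> v.
rewrite memv_cap memv_ker lfunE /= => /andP[_ /eqP h].
by rewrite memv0 -(mulKmx gu v) h mulmx0.
Qed.

(* [Id + a E_(i, i+1)] for [0 < i], [Id + a E_(n, 1)] for [i = 0]: the ordinals
   [ord_pred i] and [i] number the rows [i] (or [n] if [i = 0]) and [i + 1]. *)
Definition xmx (i : 'I_n) (a : K) : 'M[K]_n := 1%:M + a *: delta_mx (ord_pred i) i.

End Grassmannian.

(** * The data on Gr(k,n) x C^* *)

Definition zint (a b : int) : seq int :=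
  [seq a + m%:Z | m <- iota 0 (if a <= b then `|b - a|%N.+1 else 0%N)].

Section Data.
Variables (K : fieldType) (n k : nat).

Definition Xk : Type := (Gr K k n * Gm K)%type.

Definition Xk_atlas : atlas K Xk := prod_atlas (Gr_atlas K k n) (Gm_atlas K).

Implicit Types (i : 'I_n) (x : Xk).

(* In the next three definitions [insub] and [to_Gm] are defined exactly where all Plücker
   coordinates involved are nonzero, since [_ / 0 = 0]. *)

(* [~~ (1 <= i <= k)] covers [i = 0], which stands for the component [n > k]. *)
Definition Xgamma x : option (torus K n) :=
  insub (\row_(i < n)
    ((if (1 <= i <= k)%N then 1 else val x.2) *
     (plucker (zint (i%:Z - k%:Z + 1) i%:Z) x.1 /
      plucker (zint (i%:Z - k%:Z) (i%:Z - 1)) x.1))).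

Definition Xphi i x : option (Gm K) :=
  to_Gm (val x.2 ^- (i == 0 :> nat)%N *
    (plucker (rcons (zint (i%:Z - k%:Z + 1) (i%:Z - 1)) (i%:Z + 1)) x.1 /
     plucker (zint (i%:Z - k%:Z + 1) i%:Z) x.1)).

Definition Xeps i x : option (Gm K) :=
  to_Gm (val x.2 ^- (i == k :> nat)%N *
    ((plucker (rcons (zint (i%:Z - k%:Z + 1) (i%:Z - 1)) (i%:Z + 1)) x.1 *
      plucker (zint (i%:Z - k%:Z + 1) i%:Z) x.1) /
     (plucker (zint (i%:Z - k%:Z) (i%:Z - 1)) x.1 *
      plucker (zint (i%:Z - k%:Z + 2) (i%:Z + 1)) x.1))).

Definition Xe i (c : Gm K) x : option Xk :=
  if Xphi i x is Some v then
    let a := (val c - 1) / val v in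
    let a' := if (i == 0 :> nat)%N then (-1) ^+ k.-1 / val x.2 * a else a in
    Some (gr_act (xmx i a') x.1, x.2)
  else None.

Definition Xf_value x : K :=
  (\sum_(1 <= i < n.+1 | i != k)
      plucker ((i%:Z - k%:Z) :: zint (i%:Z - k%:Z + 2) i%:Z) x.1 /
      plucker (zint (i%:Z - k%:Z + 1) i%:Z) x.1) +
  val x.2 * (plucker (rcons (zint 2 k%:Z) n%:Z) x.1 / plucker (zint 1 k%:Z) x.1).

Definition Xf x : option (Gm K) :=
  if [forall i : 'I_n, plucker (zint (i%:Z - k%:Z + 1) i%:Z) x.1 != 0]
  then to_Gm (Xf_value x) else None.

End Data.

(* Main.v *)
(**
  Represent a point of Gr(k,n) by an n x k matrix and number its rows by all integers m, with
  v_(m+n) = (-1)^(k-1) v_m.  With this sign every Plücker coordinate of a cyclically increasing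
  index sequence is the determinant of the rows in that order, also when the sequence wraps around,
  and e_i^c becomes the same row operation for every i, namely
    v_m := v_m + (c-1) (P_i / N_i) v_(m+1)    for m = i mod n,
  where P_i and N_i have the index sets [i-k+1, i] and [i-k+1, i-1] U {i+1}; the variable t cancels.
  It multiplies P_i by c and fixes N_i and P_j for j <> i mod n, which gives the axioms of a
  pre-crystal and the commutation relations.  The braid relation and the decoration formula reduce
  to the three-term Plücker relations
    N_(i+1) N_i = R_i P_i + P_(i+1) T_i    and    Q_i N_i = S_i P_i + P_(i-1) P_(i+1),
  which follow from Cramer's rule; here Q_i has the index set {i-k} U [i-k+2, i], and R_i, T_i, S_i
  are the increments of N_(i+1), N_i and Q_i under the row operations i, i+1 and i.

  Being regular at a point is being a quotient of polynomials in a chart; these functions form a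
  ring.  Any two points (M1, t1), (M2, t2) lie on the rational curve of the affine combinations of
  representing matrices and of t1, t2; hence Gr(k,n) x K^* is irreducible, and finitely many generic
  conditions hold simultaneously.
*)
Require Import Defs.
From mathcomp Require Import all_boot all_order all_algebra.
From mathcomp Require Import mpoly ring zify.
From mathcomp Require Import complex reals.
From Stdlib Require Import Classical_Prop.

Set Implicit Arguments.
Unset Strict Implicit.
Unset Printing Implicit Defensive.
Import GRing.Theory Num.Theory.
Local Open Scope ring_scope.

(** * Rings of functions *)

Structure function_ring (K : fieldType) (T : Type) := FunctionRing {
  fring_mem :> (T -> K) -> Prop;
  fring_ext : forall g h, g =1 h -> fring_mem g -> fring_mem h;
  fring_cst : forall c, fring_mem (fun=> c);
  fring_add : forall g h, fring_mem g -> fring_mem h -> fring_mem (fun x => g x + h x);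
  fring_mul : forall g h, fring_mem g -> fring_mem h -> fring_mem (fun x => g x * h x) }.

Arguments fring_cst {K T f} c.

Definition entries_in (K : fieldType) (T : Type) (S : (T -> K) -> Prop) (m p : nat)
    (h : T -> 'M[K]_(m, p)) : Prop :=
  forall i j, S (fun x => h x i j).

Section FunctionRing.
Variables (K : fieldType) (T : Type) (S : function_ring K T).

Lemma fring_opp g : S g -> S (fun x => - g x).
Proof.
move=> Sg; apply: fring_ext (fring_mul (fring_cst (-1)) Sg) => x.
by rewrite mulN1r.
Qed.

Lemma fring_sub g h : S g -> S h -> S (fun x => g x - h x).
Proof. by move=> Sg Sh; apply: fring_add => //; apply: fring_opp. Qed.

Lemma fring_sum (I : Type) (r : seq I) (P : pred I) (g : I -> T -> K) :
  (forall i, P i -> S (g i)) -> S (fun x => \sum_(i <- r | P i) g i x).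
Proof.
move=> Sg; elim: r => [|i r IHr].
  by apply: fring_ext (fring_cst 0) => x; rewrite big_nil.
case Pi: (P i); last by apply: fring_ext IHr => x; rewrite big_cons Pi.
by apply: fring_ext (fring_add (Sg _ Pi) IHr) => x; rewrite big_cons Pi.
Qed.

Lemma fring_prod (I : Type) (r : seq I) (P : pred I) (g : I -> T -> K) :
  (forall i, P i -> S (g i)) -> S (fun x => \prod_(i <- r | P i) g i x).
Proof.
move=> Sg; elim: r => [|i r IHr].
  by apply: fring_ext (fring_cst 1) => x; rewrite big_nil.
case Pi: (P i); last by apply: fring_ext IHr => x; rewrite big_cons Pi.
by apply: fring_ext (fring_mul (Sg _ Pi) IHr) => x; rewrite big_cons Pi.
Qed.

Lemma fring_exp g m : S g -> S (fun x => g x ^+ m).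
Proof.
move=> Sg; elim: m => [|m IHm]; first exact: fring_cst.
by apply: fring_ext (fring_mul Sg IHm) => x; rewrite exprS.
Qed.

Lemma entries_in_cst m p (B : 'M[K]_(m, p)) : entries_in S (fun=> B).
Proof. by move=> i j; apply: fring_cst. Qed.

Lemma entries_in_scalar (g : T -> K) : S g -> entries_in S (fun x => (g x)%:M : 'M_1).
Proof. by move=> Sg i j; apply: fring_ext Sg => x; rewrite !ord1 mxE eqxx. Qed.

Lemma entries_in_add m p (g h : T -> 'M[K]_(m, p)) :
  entries_in S g -> entries_in S h -> entries_in S (fun x => g x + h x).
Proof. by move=> Sg Sh i j; apply: fring_ext (fring_add (Sg i j) (Sh i j)) => x; rewrite mxE. Qed.

Lemma entries_in_scale m p (a : T -> K) (g : T -> 'M[K]_(m, p)) :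
  S a -> entries_in S g -> entries_in S (fun x => a x *: g x).
Proof. by move=> Sa Sg i j; apply: fring_ext (fring_mul Sa (Sg i j)) => x; rewrite mxE. Qed.

Lemma entries_in_mulmx m p q (g : T -> 'M[K]_(m, p)) (h : T -> 'M[K]_(p, q)) :
  entries_in S g -> entries_in S h -> entries_in S (fun x => g x *m h x).
Proof.
move=> Sg Sh i j; apply: (@fring_ext _ _ _ (fun x => \sum_l g x i l * h x l j)) => [x|].
  by rewrite mxE.
by apply: fring_sum => l _; apply: fring_mul.
Qed.

Lemma entries_in_mxvec m p (g : T -> 'M[K]_(m, p)) :
  entries_in S g -> entries_in S (fun x => mxvec (g x)).
Proof.
move=> Sg i j; case/mxvec_indexP: j => j l.
by apply: fring_ext (Sg j l) => x; rewrite ord1 mxvecE.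
Qed.

Lemma entries_in_vec_mx m p (g : T -> 'rV[K]_(m * p)) :
  entries_in S g -> entries_in S (fun x => vec_mx (g x)).
Proof. by move=> Sg i j; apply: fring_ext (Sg 0 (mxvec_index i j)) => x; rewrite mxE. Qed.

Lemma entries_in_lsubmx m p q (g : T -> 'M[K]_(m, p + q)) :
  entries_in S g -> entries_in S (fun x => lsubmx (g x)).
Proof. by move=> Sg i j; apply: fring_ext (Sg i (lshift q j)) => x; rewrite mxE. Qed.

Lemma entries_in_rsubmx m p q (g : T -> 'M[K]_(m, p + q)) :
  entries_in S g -> entries_in S (fun x => rsubmx (g x)).
Proof. by move=> Sg i j; apply: fring_ext (Sg i (rshift p j)) => x; rewrite mxE. Qed.

Lemma entries_in_row_mx m p q (g : T -> 'M[K]_(m, p)) (h : T -> 'M[K]_(m, q)) :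
  entries_in S g -> entries_in S h -> entries_in S (fun x => row_mx (g x) (h x)).
Proof.
move=> Sg Sh i j; case: (split_ordP j) => l ->.
  by apply: fring_ext (Sg i l) => x; rewrite row_mxEl.
by apply: fring_ext (Sh i l) => x; rewrite row_mxEr.
Qed.

Lemma fring_det m (h : T -> 'M[K]_m) : entries_in S h -> S (fun x => \det (h x)).
Proof.
move=> Sh; apply: fring_sum => s _; apply: fring_mul; first exact: fring_cst.
exact: fring_prod.
Qed.

Lemma entries_in_adj m (h : T -> 'M[K]_m) : entries_in S h -> entries_in S (fun x => \adj (h x)).
Proof.
move=> Sh i j.
apply: (@fring_ext _ _ _ (fun x => (-1) ^+ (j + i) * \det (row' j (col' i (h x))))) => [x|].
  by rewrite mxE.
apply: fring_mul; first exact: fring_cst.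
by apply: fring_det => r s; apply: fring_ext (Sh (lift j r) (lift i s)) => x; rewrite !mxE.
Qed.

Lemma fring_peval m (p : {mpoly K[m]}) (h : T -> 'rV[K]_m) :
  entries_in S h -> S (fun x => peval p (h x)).
Proof.
move=> Sh; apply: (@fring_ext _ _ _ (fun x => \sum_(d <- msupp p) p@_d * \prod_i h x 0 i ^+ d i)).
  by move=> x; rewrite /peval mevalE.
apply: fring_sum => d _; apply: fring_mul; first exact: fring_cst.
by apply: fring_prod => i _; apply: fring_exp.
Qed.

End FunctionRing.

Section PolynomialFunctions.
Variables (K : fieldType) (m : nat).

Definition polyfun (g : 'rV[K]_m -> K) : Prop := exists p, forall v, g v = peval p v.

Lemma polyfun_ext g h : g =1 h -> polyfun g -> polyfun h.
Proof. by move=> gh [p gp]; exists p => v; rewrite -gh. Qed.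

Lemma polyfun_cst c : polyfun (fun=> c).
Proof. by exists c%:MP => v; rewrite /peval mevalC. Qed.

Lemma polyfun_add g h : polyfun g -> polyfun h -> polyfun (fun v => g v + h v).
Proof. by move=> [p gp] [q hq]; exists (p + q) => v; rewrite gp hq /peval mevalD. Qed.

Lemma polyfun_mul g h : polyfun g -> polyfun h -> polyfun (fun v => g v * h v).
Proof. by move=> [p gp] [q hq]; exists (p * q) => v; rewrite gp hq /peval mevalM. Qed.

Canonical polyfun_ring := FunctionRing polyfun_ext polyfun_cst polyfun_add polyfun_mul.

Lemma polyfun_coord j : polyfun (fun v => v 0 j).
Proof. by exists 'X_j => v; rewrite /peval mevalXU. Qed.

Lemma polyfun_id : entries_in polyfun (fun v : 'rV[K]_m => v).
Proof. by move=> i j; rewrite ord1; apply: polyfun_coord. Qed.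

Lemma algebraic_set_ext (V W : 'rV[K]_m -> Prop) :
  (forall v, V v <-> W v) -> algebraic_set V -> algebraic_set W.
Proof. by move=> VW [S VS]; exists S => v; rewrite -VW. Qed.

Lemma algebraic_set_zeros (I : Type) (g : I -> 'rV[K]_m -> K) :
  (forall i, polyfun (g i)) -> algebraic_set (fun v => forall i, g i v = 0).
Proof.
move=> pg; exists (fun p => exists i, forall v, g i v = peval p v) => v.
split=> [gv p [i gi]|pv i]; first by rewrite -gi.
by have [p gp] := pg i; rewrite gp; apply: pv; exists i.
Qed.

Lemma algebraic_setT : algebraic_set (fun _ : 'rV[K]_m => True).
Proof. by exists (fun=> False). Qed.

Lemma algebraic_setI (V W : 'rV[K]_m -> Prop) :
  algebraic_set V -> algebraic_set W -> algebraic_set (fun v => V v /\ W v).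
Proof.
move=> [S VS] [S' WS']; exists (fun p => S p \/ S' p) => v; rewrite VS WS'.
split=> [[Sv S'v] p []|SS']; [exact: Sv | exact: S'v |].
by split=> p Sp; apply: SS'; [left | right].
Qed.

Lemma algebraic_set_preim d (h : 'rV[K]_m -> 'rV[K]_d) (V : 'rV[K]_d -> Prop) :
  entries_in polyfun h -> algebraic_set V -> algebraic_set (fun v => V (h v)).
Proof.
move=> ph [S VS].
have := @algebraic_set_zeros {p | S p} (fun p v => peval (sval p) (h v)).
move=> /(_ (fun _ => fring_peval _ ph)); apply: algebraic_set_ext => v.
by rewrite VS; split=> [Sv p Sp|Sv [p Sp]]; [apply: (Sv (exist _ p Sp)) | apply: Sv].
Qed.

Lemma algebraic_mx_eq p q (g h : 'rV[K]_m -> 'M[K]_(p, q)) :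
  entries_in polyfun g -> entries_in polyfun h -> algebraic_set (fun v => g v = h v).
Proof.
move=> pg ph; have := @algebraic_set_zeros _ (fun ij v => g v ij.1 ij.2 - h v ij.1 ij.2).
move=> /(_ (fun ij => fring_sub (pg _ _) (ph _ _))); apply: algebraic_set_ext => v.
split=> [gh|-> ij]; last exact: subrr.
by apply/matrixP => i j; apply/eqP; rewrite -subr_eq0 (gh (i, j)).
Qed.

End PolynomialFunctions.

(** * Regular functions and rational maps *)

Section Germs.
Variables (K : fieldType) (X : Type) (A : atlas K X).

Definition near_in (a : chart_idx A) (x : X) (P : X -> Prop) : Prop :=
  exists2 q : {mpoly K[chart_dim a]}, peval q (chart a x) != 0 &
    forall y, chart_dom a y -> peval q (chart a y) != 0 -> P y.

Definition regular_in (a : chart_idx A) (x : X) (g : X -> K) : Prop :=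
  exists p q : {mpoly K[chart_dim a]}, peval q (chart a x) != 0 /\
    forall y, chart_dom a y -> peval q (chart a y) != 0 ->
      g y = peval p (chart a y) / peval q (chart a y).

Section FixedChart.
Variables (a : chart_idx A) (x : X).

Lemma near_inT (P : X -> Prop) : (forall y, chart_dom a y -> P y) -> near_in a x P.
Proof. by move=> allP; exists 1 => [|y ay _]; [rewrite /peval meval1 oner_neq0 | exact: allP]. Qed.

Lemma near_inW (P Q : X -> Prop) :
  (forall y, chart_dom a y -> P y -> Q y) -> near_in a x P -> near_in a x Q.
Proof. by move=> PQ [q qx qP]; exists q => // y ay qy; apply: PQ (qP y ay qy). Qed.

Lemma near_inI (P Q : X -> Prop) :
  near_in a x P -> near_in a x Q -> near_in a x (fun y => P y /\ Q y).
Proof.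
move=> [p px pP] [q qx qQ]; exists (p * q) => [|y ay].
  by rewrite /peval mevalM mulf_neq0.
by rewrite /peval mevalM mulf_eq0 negb_or => /andP[py qy]; split; [apply: pP | apply: qQ].
Qed.

Lemma near_in_forall (I : finType) (P : I -> X -> Prop) :
  (forall i, near_in a x (P i)) -> near_in a x (fun y => forall i, P i y).
Proof.
move=> nP; suff: near_in a x (fun y => forall i, i \in enum I -> P i y).
  by apply: near_inW => y _ Py i; apply: Py; rewrite mem_enum.
elim: (enum I) => [|i s IHs]; first exact: near_inT.
apply: near_inW (near_inI (nP i) IHs) => y _ [Piy Py] j.
by rewrite inE => /predU1P[->|/Py].
Qed.

Lemma regular_in_peval (p : {mpoly K[chart_dim a]}) :
  regular_in a x (fun y => peval p (chart a y)).
Proof.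
by exists p, 1; split=> [|y _ _]; rewrite /peval meval1 ?oner_neq0 ?divr1.
Qed.

Lemma regular_in_near_eq (g h : X -> K) :
  near_in a x (fun y => g y = h y) -> regular_in a x g -> regular_in a x h.
Proof.
move=> [r rx gh] [p [q [qx gpq]]]; exists (p * r), (q * r).
rewrite /peval mevalM mulf_neq0 //; split=> // y ay.
rewrite mevalM mulf_eq0 negb_or => /andP[qy ry]; rewrite -gh // gpq // /peval !mevalM.
by field; rewrite qy ry.
Qed.

Lemma regular_in_ext g h : g =1 h -> regular_in a x g -> regular_in a x h.
Proof. by move=> gh; apply: regular_in_near_eq; apply: near_inT. Qed.

Lemma regular_in_cst c : regular_in a x (fun=> c).
Proof. by apply: regular_in_ext (regular_in_peval c%:MP) => y; rewrite /peval mevalC. Qed.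

Lemma regular_in_add g h :
  regular_in a x g -> regular_in a x h -> regular_in a x (fun y => g y + h y).
Proof.
move=> [p [q [qx gpq]]] [p' [q' [q'x hpq]]]; exists (p * q' + p' * q), (q * q').
rewrite /peval mevalM mulf_neq0 //; split=> // y ay.
rewrite mevalM mulf_eq0 negb_or => /andP[qy q'y]; rewrite gpq // hpq // /peval mevalD !mevalM.
by field; rewrite qy q'y.
Qed.

Lemma regular_in_mul g h :
  regular_in a x g -> regular_in a x h -> regular_in a x (fun y => g y * h y).
Proof.
move=> [p [q [qx gpq]]] [p' [q' [q'x hpq]]]; exists (p * p'), (q * q').
rewrite /peval mevalM mulf_neq0 //; split=> // y ay.
rewrite mevalM mulf_eq0 negb_or => /andP[qy q'y]; rewrite gpq // hpq // /peval !mevalM.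
by field; rewrite qy q'y.
Qed.

Canonical regular_in_ring :=
  FunctionRing regular_in_ext regular_in_cst regular_in_add regular_in_mul.

Lemma entries_in_near_eq m p (g h : X -> 'M[K]_(m, p)) :
  near_in a x (fun y => g y = h y) ->
  entries_in (regular_in a x) g -> entries_in (regular_in a x) h.
Proof.
by move=> gh rg i j; apply: regular_in_near_eq (rg i j); apply: near_inW gh => y _ ->.
Qed.

Lemma entries_in_chart : entries_in (regular_in a x) (chart a).
Proof.
move=> i j; apply: regular_in_near_eq (regular_in_peval 'X_j).
by apply: near_inT => y _; rewrite ord1 /peval mevalXU.
Qed.

Hypothesis ax : chart_dom a x.

Lemma near_in_self P : near_in a x P -> P x.
Proof. by move=> [q qx]; apply. Qed.

Lemma regular_in_neq0 g : regular_in a x g -> g x != 0 -> near_in a x (fun y => g y != 0).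
Proof.
move=> [p [q [qx gpq]]]; rewrite (gpq x ax qx) mulf_eq0 negb_or => /andP[px _].
exists (p * q) => [|y ay]; rewrite /peval mevalM; first exact: mulf_neq0.
by rewrite mulf_eq0 negb_or => /andP[py qy]; rewrite gpq // mulf_neq0 ?invr_eq0.
Qed.

Lemma regular_inV g : regular_in a x g -> g x != 0 -> regular_in a x (fun y => (g y)^-1).
Proof.
move=> [p [q [qx gpq]]]; rewrite (gpq x ax qx) mulf_eq0 negb_or => /andP[px _].
apply: (@regular_in_near_eq (fun y => peval q (chart a y) / peval p (chart a y))).
  by exists q => // y ay qy; rewrite gpq // invf_div.
by exists q, p.
Qed.

Lemma regular_in_div g h :
  regular_in a x g -> regular_in a x h -> h x != 0 -> regular_in a x (fun y => g y / h y).
Proof. by move=> rg rh hx; apply: fring_mul => //; apply: regular_inV. Qed.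

Lemma near_in_unitmx m (h : X -> 'M[K]_m) : entries_in (regular_in a x) h ->
  h x \in unitmx -> near_in a x (fun y => h y \in unitmx).
Proof.
move=> rh; rewrite unitmxE unitfE => /(regular_in_neq0 (fring_det rh)).
by apply: near_inW => y _; rewrite unitmxE unitfE.
Qed.

Lemma entries_in_invmx m (h : X -> 'M[K]_m) : entries_in (regular_in a x) h ->
  h x \in unitmx -> entries_in (regular_in a x) (fun y => invmx (h y)).
Proof.
move=> rh ux; apply: (@entries_in_near_eq _ _ (fun y => (\det (h y))^-1 *: \adj (h y))).
  by apply: near_inW (near_in_unitmx rh ux) => y _ uy; rewrite /invmx uy.
apply: entries_in_scale; last exact: entries_in_adj.
by apply: regular_inV; [apply: fring_det | rewrite -unitfE -unitmxE].
Qed.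

End FixedChart.

Lemma zopenP (U : X -> Prop) :
  zopen A U <-> forall a x, chart_dom a x -> U x -> near_in a x U.
Proof.
split=> [opU a x ax Ux|nU a].
  have [S SE] := opU a.
  have [p [Sp px]] : exists p, S p /\ peval p (chart a x) <> 0.
    apply: NNPP => nex; have []// : ~ U x.
    by apply/(SE x ax) => p Sp; apply: NNPP => px; apply: nex; exists p.
  exists p => [|y ay /eqP py]; first exact/eqP.
  by apply: NNPP => nUy; apply: py; move/(SE y ay): nUy; apply.
exists (fun p => forall y, chart_dom a y -> peval p (chart a y) != 0 -> U y).
move=> x ax; split=> [nUx p pU|pU Ux].
  by apply/eqP/negP => /negP px; apply: nUx; apply: pU.
by have [q qx qU] := nU a x ax Ux; move: qx; rewrite (pU q qU) eqxx.
Qed.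

Lemma zopenT : zopen A (fun=> True).
Proof. by apply/zopenP => a x _ _; apply: near_inT. Qed.

Lemma zopenI (U V : X -> Prop) : zopen A U -> zopen A V -> zopen A (fun x => U x /\ V x).
Proof.
rewrite !zopenP => opU opV a x ax [Ux Vx].
by apply: near_inI; [apply: opU | apply: opV].
Qed.

Lemma zopen_setC (Z : X -> Prop) : zclosed A Z -> zopen A (fun x => ~ Z x).
Proof.
move=> clZ a; have [S SE] := clZ a; exists S => x ax; rewrite -(SE x ax).
by split=> [/NNPP|Zx nZx] //; apply: nZx.
Qed.

Lemma regular_of_regular_in (U : X -> Prop) g :
  (forall x, U x -> exists2 a, chart_dom a x & regular_in a x g) -> regular A U g.
Proof.
move=> rg x Ux; have [a ax [p [q [qx gpq]]]] := rg x Ux.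
by exists a, p, q; split=> // y _ ay; apply: gpq.
Qed.

Hypothesis varA : is_variety A.

Lemma chart_transition (a b : chart_idx A) x : chart_dom a x -> chart_dom b x ->
  near_in b x (chart_dom a) /\ entries_in (regular_in b x) (chart a).
Proof.
move=> ax bx; have nab : near_in b x (chart_dom a).
  by move/zopenP: (var_dom_open varA a); apply.
split=> // i j; rewrite ord1; have [p [q [qx pq]]] := var_transition varA j bx ax.
apply: (@regular_in_near_eq _ _ (fun y => peval p (chart b y) / peval q (chart b y))).
  have nq : near_in b x (fun y => peval q (chart b y) != 0) by exists q.
  by apply: near_inW (near_inI nab nq) => y byy [ay qy]; rewrite pq.
by exists p, q.
Qed.

Lemma regular_in_of_regular (U : X -> Prop) g b x :
  zopen A U -> U x -> regular A U g -> chart_dom b x -> regular_in b x g.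
Proof.
move=> opU Ux /(_ x Ux)[a [p [q [ax qx gpq]]]] bx.
have [nab rab] := chart_transition ax bx; have nU := (zopenP U).1 opU b x bx Ux.
have [rp rq] := (fring_peval p rab, fring_peval q rab).
apply: regular_in_near_eq (regular_in_div bx rp rq qx).
apply: near_inW (near_inI (near_inI nab nU) (regular_in_neq0 bx rq qx)) => y _ [[ay Uy] qy].
by rewrite gpq.
Qed.

End Germs.

Section RationalMaps.
Variables (K : fieldType) (X Y : Type) (A : atlas K X) (B : atlas K Y).

Definition rational_at (a : chart_idx A) (x : X) (F : X -> option Y) : Prop :=
  exists (b : chart_idx B) (h : X -> 'rV[K]_(chart_dim b)),
    entries_in (regular_in a x) h /\
    near_in a x (fun x' => exists2 y, F x' = Some y & chart_dom b y /\ chart b y = h x').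

Hypotheses (varA : is_variety A) (varB : is_variety B).

Lemma is_rational_of_local (F : X -> option Y) :
  (exists x y, F x = Some y) ->
  (forall a x y, chart_dom a x -> F x = Some y -> rational_at a x F) ->
  is_rational A B F.
Proof.
move=> neF locF; split=> // V opV; split.
  apply/zopenP => a x ax [y Fx Vy]; have [b [h [rh nF]]] := locF a x y ax Fx.
  have [y' + [byy yh]] := near_in_self ax nF; rewrite Fx => -[yy']; rewrite -{}yy' in byy yh.
  have [q qy qV] := (zopenP B V).1 opV b y byy Vy; rewrite yh in qy.
  apply: near_inW (near_inI nF (regular_in_neq0 ax (fring_peval q rh) qy)).
  by move=> x' _ [[w Fx' [bw <-]] qw]; exists w => //; apply: qV.
move=> g rg; apply: regular_of_regular_in => x [y Fx Vy].
have [a ax] := var_cover varA x; exists a => //; have [b [h [rh nF]]] := locF a x y ax Fx.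
have [y' + [byy yh]] := near_in_self ax nF; rewrite Fx => -[yy']; rewrite -{}yy' in byy yh.
have [p [q [qy gpq]]] := regular_in_of_regular varB opV Vy rg byy; rewrite yh in qy.
have [rp rq] := (fring_peval p rh, fring_peval q rh).
apply: regular_in_near_eq (regular_in_div ax rp rq qy).
apply: near_inW (near_inI nF (regular_in_neq0 ax rq qy)) => x' _ [[w -> [bw <-]] qw].
by rewrite /= gpq.
Qed.

Lemma rational_domain_generic (F : X -> option Y) :
  is_rational A B F -> generically A (fun x => exists y, F x = Some y).
Proof.
move=> [[x [y Fx]] ratF]; exists (preim_opt F (fun=> True)); split.
- by have [] := ratF _ (@zopenT _ _ B).
- by exists x, y.
- by move=> z [y' Fz _]; exists y'.
Qed.

End RationalMaps.

Lemma is_rational_id (K : fieldType) (X : Type) (A : atlas K X) :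
  is_variety A -> (exists x : X, True) -> is_rational A A Some.
Proof.
move=> varA [x0 _]; apply: is_rational_of_local => //; first by exists x0, x0.
move=> a x _ _ _; exists a, (chart a); split; first exact: entries_in_chart.
by apply: near_inT => y ay; exists y.
Qed.

Lemma is_rational_comp (K : fieldType) (X Y Z : Type)
    (A : atlas K X) (B : atlas K Y) (C : atlas K Z) (F : X -> option Y) (G : Y -> option Z) :
  is_rational A B F -> is_rational B C G ->
  (exists x z, obind G (F x) = Some z) -> is_rational A C (fun x => obind G (F x)).
Proof.
move=> [_ ratF] [_ ratG] neGF; split=> // V opV.
have preimE x : preim_opt F (preim_opt G V) x <-> preim_opt (fun x => obind G (F x)) V x.
  split=> [[y Fx [z Gy Vz]]|[z]]; first by exists z; rewrite // Fx.
  by case Fx: (F x) => [y|] //= Gy Vz; exists y => //; exists z.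
have [opG regG] := ratG V opV; have [opGF regGF] := ratF _ opG; split.
  by move=> a; have [S SE] := opGF a; exists S => x ax; rewrite -(SE x ax) preimE.
move=> g rg x /preimE GFx; have [a [p [q [ax qx gpq]]]] := regGF _ (regG g rg) x GFx.
exists a, p, q; split=> // y /preimE GFy ay qy; rewrite -gpq //.
by case: GFy => z ->.
Qed.

(** * Products, affine varieties and irreducibility *)

Section Product.
Variables (K : fieldType) (X Y : Type) (A : atlas K X) (B : atlas K Y).
Local Notation AB := (prod_atlas A B).

Section FixedCharts.
Variables (a : chart_idx A) (b : chart_idx B) (z : X * Y).
Let ab : chart_idx AB := (a, b).

Lemma peval_fst (p : {mpoly K[chart_dim a]}) : exists q : {mpoly K[chart_dim ab]},
  forall w, peval q (chart ab w) = peval p (chart a w.1).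
Proof.
have [q qE] := fring_peval p (entries_in_lsubmx (@polyfun_id K (chart_dim a + chart_dim b))).
by exists q => w; rewrite -qE row_mxKl.
Qed.

Lemma peval_snd (p : {mpoly K[chart_dim b]}) : exists q : {mpoly K[chart_dim ab]},
  forall w, peval q (chart ab w) = peval p (chart b w.2).
Proof.
have [q qE] := fring_peval p (entries_in_rsubmx (@polyfun_id K (chart_dim a + chart_dim b))).
by exists q => w; rewrite -qE row_mxKr.
Qed.

Lemma near_in_fst P : near_in a z.1 P -> near_in ab z (fun w => P w.1).
Proof.
move=> [p px pP]; have [q qE] := peval_fst p.
by exists q => [|w [aw _]]; rewrite qE //; apply: pP.
Qed.

Lemma near_in_snd P : near_in b z.2 P -> near_in ab z (fun w => P w.2).
Proof.
move=> [p px pP]; have [q qE] := peval_snd p.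
by exists q => [|w [_ bw]]; rewrite qE //; apply: pP.
Qed.

Lemma regular_in_fst g : regular_in a z.1 g -> regular_in ab z (fun w => g w.1).
Proof.
move=> [p [q [qx gpq]]]; have [[p' pE] [q' qE]] := (peval_fst p, peval_fst q).
by exists p', q'; rewrite qE; split=> // w [aw _]; rewrite pE qE; apply: gpq.
Qed.

Lemma regular_in_snd g : regular_in b z.2 g -> regular_in ab z (fun w => g w.2).
Proof.
move=> [p [q [qx gpq]]]; have [[p' pE] [q' qE]] := (peval_snd p, peval_snd q).
by exists p', q'; rewrite qE; split=> // w [_ bw]; rewrite pE qE; apply: gpq.
Qed.

Lemma entries_in_fst m p (h : X -> 'M[K]_(m, p)) :
  entries_in (regular_in a z.1) h -> entries_in (regular_in ab z) (fun w => h w.1).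
Proof. by move=> rh i j; apply: regular_in_fst (rh i j). Qed.

Lemma entries_in_snd m p (h : Y -> 'M[K]_(m, p)) :
  entries_in (regular_in b z.2) h -> entries_in (regular_in ab z) (fun w => h w.2).
Proof. by move=> rh i j; apply: regular_in_snd (rh i j). Qed.

End FixedCharts.

Hypotheses (varA : is_variety A) (varB : is_variety B).

Lemma zopen_fst (U : X -> Prop) : zopen A U -> zopen AB (fun z => U z.1).
Proof.
move=> /zopenP opU; apply/zopenP => -[a b] z [/= az _] Uz.
exact: near_in_fst (opU a z.1 az Uz).
Qed.

Lemma prod_affine (ab : chart_idx AB) :
  algebraic_set (fun v => exists2 z, chart_dom ab z & chart ab z = v).
Proof.
case: ab => a b /=; have pid := @polyfun_id K (chart_dim a + chart_dim b).
have algA := algebraic_set_preim (entries_in_lsubmx pid) (var_affine varA a).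
have algB := algebraic_set_preim (entries_in_rsubmx pid) (var_affine varB b).
apply: algebraic_set_ext (algebraic_setI algA algB) => v; split.
  move=> [[x ax xv] [y byy yv]]; exists (x, y) => //=.
  by rewrite xv yv hsubmxK.
move=> [[x y] [/= ax byy] <-].
by split; [exists x | exists y]; rewrite ?row_mxKl ?row_mxKr.
Qed.

Lemma prod_separated (ab ab' : chart_idx AB) :
  algebraic_set (fun v => exists z,
    [/\ chart_dom ab z, chart_dom ab' z & v = row_mx (chart ab z) (chart ab' z)]).
Proof.
case: ab ab' => [a b] [a' b'] /=.
have pid := @polyfun_id K (chart_dim a + chart_dim b + (chart_dim a' + chart_dim b')).
have [pl pr] := (entries_in_lsubmx pid, entries_in_rsubmx pid).
have algA := algebraic_set_preim
  (entries_in_row_mx (entries_in_lsubmx pl) (entries_in_lsubmx pr)) (var_separated varA a a').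
have algB := algebraic_set_preim
  (entries_in_row_mx (entries_in_rsubmx pl) (entries_in_rsubmx pr)) (var_separated varB b b').
apply: algebraic_set_ext (algebraic_setI algA algB) => v; split.
  move=> [[x [ax ax' /eq_row_mx[xv xv']]] [y [byy by' /eq_row_mx[yv yv']]]].
  by exists (x, y); split=> //=; rewrite -xv -xv' -yv -yv' !hsubmxK.
move=> [[x y] [[/= ax byy] [ax' by'] ->]].
by split; [exists x | exists y]; split; rewrite // ?row_mxKl ?row_mxKr ?row_mxKl ?row_mxKr.
Qed.

Lemma prod_variety : is_variety AB.
Proof.
split.
- move=> [x y]; have [[a ax] [b byy]] := (var_cover varA x, var_cover varB y).
  by exists (a, b).
- move=> [a b] [x y] [x' y'] [/= ax byy] [/= ax' by'] /eq_row_mx[xx' yy'].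
  by rewrite (var_inj varA ax ax' xx') (var_inj varB byy by' yy').
- exact: prod_affine.
- move=> [a b]; apply/zopenP => -[a' b'] z [/= az bz] [/= az' bz'].
  have [na _] := chart_transition varA az' az; have [nb _] := chart_transition varB bz' bz.
  exact: near_inI (near_in_fst b' na) (near_in_snd a' nb).
- move=> [a b] [a' b'] j z [/= az bz] [/= az' bz'].
  have [_ ra] := chart_transition varA az' az; have [_ rb] := chart_transition varB bz' bz.
  have : regular_in ((a, b) : chart_idx AB) z (fun w => row_mx (chart a' w.1) (chart b' w.2) 0 j).
    by apply: entries_in_row_mx; [apply: entries_in_fst | apply: entries_in_snd].
  by move=> [p [q [qz pq]]]; exists p, q; split=> // w dw _; apply: pq.
- exact: prod_separated.
Qed.

Lemma is_rational_pairr (x : X) : (exists y : Y, True) ->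
  is_rational B AB (fun y => Some (x, y)).
Proof.
move=> [y0 _]; have [a ax] := var_cover varA x; have varAB := prod_variety.
apply: is_rational_of_local => //; first by exists y0, (x, y0).
move=> b y _ byy _; exists (a, b), (fun y => row_mx (chart a x) (chart b y)); split.
  by apply: entries_in_row_mx; [apply: entries_in_cst | apply: entries_in_chart].
by apply: near_inT => y' by'; exists (x, y').
Qed.

End Product.

Definition affine_atlas (K : fieldType) (X : Type) (d : nat) (c : X -> 'rV[K]_d) : atlas K X :=
  @Atlas K X unit (fun=> d) (fun _ _ => True) (fun=> c).

Lemma affine_variety (K : fieldType) (X : Type) (d : nat) (c : X -> 'rV[K]_d) :
  injective c -> algebraic_set (fun v => exists x, c x = v) -> is_variety (affine_atlas c).
Proof.
move=> injc algc; split=> /=.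
- by move=> x; exists tt.
- by move=> _ x y _ _; apply: injc.
- by move=> _; apply: algebraic_set_ext algc => v; split=> [[x cx]|[x _ cx]]; exists x.
- by move=> _; apply: zopenT.
- move=> _ _ j x _ _; exists 'X_j, 1; split=> [|y _ _ _]; rewrite /peval meval1 ?oner_neq0 //.
  by rewrite divr1 mevalXU.
- move=> _ _; have pid := @polyfun_id K (d + d).
  have [pl pr] := (entries_in_lsubmx pid, entries_in_rsubmx pid).
  have algl := algebraic_set_preim pl algc; have alglr := algebraic_mx_eq pl pr.
  apply: algebraic_set_ext (algebraic_setI algl alglr) => w; split.
    by move=> [[x cx] lr]; exists x; split; rewrite // cx -[LHS]hsubmxK -lr.
  by move=> [x [_ _ ->]]; rewrite row_mxKl row_mxKr; split=> //; exists x.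
Qed.

Definition row_with_inv (K : fieldType) (n : nat) (z : 'rV[K]_n) : 'rV[K]_(n + n) :=
  row_mx z (map_mx GRing.inv z).

Lemma algebraic_row_with_inv (K : fieldType) (n : nat) :
  algebraic_set (fun v : 'rV[K]_(n + n) =>
    exists2 z : 'rV_n, (forall i, z 0 i != 0) & row_with_inv z = v).
Proof.
have pid := @polyfun_id K (n + n).
have := @algebraic_set_zeros K (n + n) 'I_n (fun i v => v 0 (lshift n i) * v 0 (rshift n i) - 1).
move=> /(_ (fun i => fring_sub (fring_mul (pid _ _) (pid _ _)) (fring_cst _))).
apply: algebraic_set_ext => v; split=> [v1|[z z0 <-] i]; last first.
  by rewrite row_mxEl row_mxEr mxE divff ?subrr.
have {}v1 i : v 0 (lshift n i) * v 0 (rshift n i) = 1 by apply/eqP; rewrite -subr_eq0 v1.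
have v0 i : v 0 (lshift n i) != 0.
  by apply: contra_eq_neq (v1 i) => ->; rewrite mul0r eq_sym oner_neq0.
exists (lsubmx v) => [i|]; first by rewrite mxE.
rewrite -[RHS]hsubmxK; congr row_mx.
by apply/rowP => i; rewrite !mxE -[LHS]mulr1 -(v1 i) mulKf.
Qed.

Lemma torus_variety (K : fieldType) (n : nat) : is_variety (torus_atlas K n).
Proof.
apply: (affine_variety (c := fun z : torus K n => row_with_inv (val z))).
  by move=> z z' /eq_row_mx[/val_inj].
apply: algebraic_set_ext (algebraic_row_with_inv K n) => v; split=> [[z z0 <-]|[z <-]].
  have zP : [forall i, z 0 i != 0] by apply/forallP.
  by exists (exist _ z zP).
by exists (val z) => // i; apply: (forallP (valP z)).
Qed.

Lemma Gm_chartE (K : fieldType) (c : Gm K) :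
  @chart _ _ (Gm_atlas K) tt c = row_with_inv ((val c)%:M : 'rV_1).
Proof.
apply/rowP => j; rewrite mxE /=; case: (split_ordP (j : 'I_(1 + 1))) => l ->.
  by rewrite row_mxEl ord1 mxE eqxx.
by rewrite row_mxEr ord1 !mxE eqxx.
Qed.

Lemma Gm_variety (K : fieldType) : is_variety (Gm_atlas K).
Proof.
apply: (affine_variety (c := @chart _ _ (Gm_atlas K) tt)).
  by move=> c c' /rowP/(_ 0); rewrite !mxE /= => /val_inj.
apply: algebraic_set_ext (algebraic_row_with_inv K 1) => v; split=> [[z z0 <-]|[c <-]].
  by exists (exist _ (z 0 0) (z0 0)); rewrite Gm_chartE [in RHS](mx11_scalar z).
exists (val c)%:M; rewrite ?Gm_chartE // => i.
by rewrite ord1 mxE eqxx; apply: (valP c).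
Qed.

Lemma regular_in_val_Gm (K : fieldType) (c : Gm K) : regular_in (tt : chart_idx (Gm_atlas K)) c val.
Proof.
apply: fring_ext (@entries_in_chart _ _ (Gm_atlas K) tt c 0 (0 : 'I_2)) => c'.
by rewrite mxE.
Qed.

Lemma to_GmP (K : fieldType) (a : K) (c : Gm K) : to_Gm a = Some c <-> val c = a.
Proof. by split=> [|<-]; rewrite /to_Gm ?valK //; case: insubP => // c' _ <- [<-]. Qed.

Lemma to_Gm_Some (K : fieldType) (a : K) : a != 0 -> exists2 c, to_Gm a = Some c & val c = a.
Proof. by move=> a0; exists (Sub a a0) => //; apply/to_GmP. Qed.

Section MapsIntoTori.
Variables (K : fieldType) (X : Type) (A : atlas K X) (a : chart_idx A) (x : X).
Hypothesis ax : chart_dom a x.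

Lemma entries_in_row_with_inv n (h : X -> 'rV[K]_n) : entries_in (regular_in a x) h ->
  (forall i, h x 0 i != 0) -> entries_in (regular_in a x) (fun y => row_with_inv (h y)).
Proof.
move=> rh h0; apply: entries_in_row_mx => // i j; rewrite ord1.
by apply: fring_ext (regular_inV ax (rh 0 j) (h0 j)) => y; rewrite mxE.
Qed.

Lemma rational_at_torus n (F : X -> option (torus K n)) (h : X -> 'rV[K]_n) :
  entries_in (regular_in a x) h -> (forall i, h x 0 i != 0) ->
  near_in a x (fun y => F y = insub (h y)) -> rational_at (torus_atlas K n) a x F.
Proof.
move=> rh h0 nF; exists tt, (fun y => row_with_inv (h y)).
split; first exact: entries_in_row_with_inv.
have nh := near_in_forall (fun i => regular_in_neq0 ax (rh 0 i) (h0 i)).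
apply: near_inW (near_inI nF nh) => y _ [-> hy0].
have hyP : [forall i, h y 0 i != 0] by apply/forallP.
by exists (exist _ (h y) hyP); rewrite ?insubT.
Qed.

Lemma rational_at_Gm (F : X -> option (Gm K)) (g : X -> K) :
  regular_in a x g -> g x != 0 ->
  near_in a x (fun y => F y = to_Gm (g y)) -> rational_at (Gm_atlas K) a x F.
Proof.
move=> rg g0 nF; exists tt, (fun y => row_with_inv ((g y)%:M : 'rV_1)).
split.
  by apply: entries_in_row_with_inv; [apply: entries_in_scalar | move=> i; rewrite ord1 mxE eqxx].
apply: near_inW (near_inI nF (regular_in_neq0 ax rg g0)) => y _ [-> gy0].
by have [c -> <-] := to_Gm_Some gy0; exists c; rewrite ?Gm_chartE.
Qed.

End MapsIntoTori.

Definition line_atlas (K : fieldType) : atlas K K := affine_atlas (fun s : K => s%:M : 'rV_1).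

Lemma line_variety (K : fieldType) : is_variety (line_atlas K).
Proof.
apply: affine_variety; first by move=> s s' /rowP/(_ 0); rewrite !mxE.
apply: algebraic_set_ext (algebraic_setT K 1) => v; split=> // _.
by exists (v 0 0); rewrite [RHS]mx11_scalar.
Qed.

Lemma regular_in_line_id (K : fieldType) (s : K) :
  regular_in (tt : chart_idx (line_atlas K)) s id.
Proof.
apply: fring_ext (@entries_in_chart _ _ (line_atlas K) tt s 0 (0 : 'I_1)) => s'.
by rewrite mxE eqxx.
Qed.

Definition infinite_type (T : Type) : Prop := exists u : nat -> T, injective u.

Section InfiniteField.
Variable K : fieldType.
Hypothesis K_infinite : infinite_type K.

Lemma poly_nonroot (p : {poly K}) : p != 0 -> exists s, p.[s] != 0.
Proof.
have [u inj_u] := K_infinite; move=> p0; apply: NNPP => nex.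
have /(_ (map u (iota 0 (size p)))) := max_poly_roots p0.
rewrite map_inj_uniq // iota_uniq size_map size_iota ltnn.
suff -> : all (root p) (map u (iota 0 (size p))) by move/(_ isT isT).
by apply/allP => s _; apply/negPn/negP => ps; apply: nex; exists s.
Qed.

Lemma peval_scalar (q : {mpoly K[1]}) :
  exists p : {poly K}, forall s, peval q s%:M = p.[s].
Proof.
exists (\sum_(d <- msupp q) (q@_d)%:P * \prod_i 'X ^+ d i) => s.
rewrite /peval mevalE horner_sum; apply: eq_bigr => d _.
rewrite hornerM hornerC horner_prod; congr (_ * _); apply: eq_bigr => i _.
by rewrite hornerXn ord1 mxE eqxx.
Qed.

Lemma zopen_line (U : K -> Prop) s0 : zopen (line_atlas K) U -> U s0 ->
  exists2 p : {poly K}, p != 0 & forall s, p.[s] != 0 -> U s.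
Proof.
move=> /zopenP/(_ tt s0 I)/[apply]-[q qs qU]; have [p pE] := peval_scalar q.
exists p => [|s ps]; last by apply: qU; rewrite //= pE.
by apply: contraNneq qs => p0; rewrite /= pE p0 horner0.
Qed.

Lemma irreducible_of_rational_curves (X : Type) (A : atlas K X) :
  (exists x : X, True) ->
  (forall x1 x2, exists F : K -> option X,
     [/\ is_rational (line_atlas K) A F, F 0 = Some x1 & F 1 = Some x2]) ->
  irreducible_space A.
Proof.
move=> neX curves; split=> // Z1 Z2 cl1 cl2 Z12; apply: NNPP => nZ.
have [x1 nZ1] : exists x1, ~ Z1 x1.
  by apply: NNPP => nex; apply: nZ; left => x; apply: NNPP => nZx; apply: nex; exists x.
have [x2 nZ2] : exists x2, ~ Z2 x2.
  by apply: NNPP => nex; apply: nZ; right => x; apply: NNPP => nZx; apply: nex; exists x.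
have [F [[_ ratF] F0 F1]] := curves x1 x2.
have [op1 _] := ratF _ (zopen_setC cl1); have [op2 _] := ratF _ (zopen_setC cl2).
have [|p1 p10 p1P] := zopen_line (s0 := 0) op1; first by exists x1.
have [|p2 p20 p2P] := zopen_line (s0 := 1) op2; first by exists x2.
have [s] := poly_nonroot (mulf_neq0 p10 p20).
rewrite hornerM mulf_eq0 negb_or => /andP[/p1P[y Fs nZy] /p2P[y' Fs' nZy']].
by move: Fs' nZy'; rewrite Fs => -[<-] nZy'; case: (Z12 y).
Qed.

End InfiniteField.

Section Generic.
Variables (K : fieldType) (X : Type) (A : atlas K X).

Lemma genericallyW (P Q : X -> Prop) :
  (forall x, P x -> Q x) -> generically A P -> generically A Q.
Proof. by move=> PQ [U [opU neU UP]]; exists U; split=> // x /UP/PQ. Qed.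

Lemma generically_exists (P : X -> Prop) : generically A P -> exists x, P x.
Proof. by move=> [U [_ [x Ux] UP]]; exists x; apply: UP. Qed.

Lemma rat_eq_sym (Y : Type) (F G : X -> option Y) : Defs.rat_eq A F G -> Defs.rat_eq A G F.
Proof. by apply: genericallyW => x [y Fx Gx]; exists y. Qed.

Hypothesis irrA : irreducible_space A.

Lemma generically_and (P Q : X -> Prop) :
  generically A P -> generically A Q -> generically A (fun x => P x /\ Q x).
Proof.
move=> [U [opU [x Ux] UP]] [V [opV [y Vy] VQ]].
exists (fun x => U x /\ V x); split; [exact: zopenI | | by move=> z [/UP ? /VQ]].
apply: NNPP => nUV; have [_ irr] := irrA.
have [z|/(_ x)|/(_ y)] := irr _ _ opU opV => //.
by case: (classic (U z)) => [Uz|]; [right => Vz; apply: nUV; exists z | left].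
Qed.

Lemma generically_forall (I : finType) (P : I -> X -> Prop) :
  (forall i, generically A (P i)) -> generically A (fun x => forall i, P i x).
Proof.
move=> gP; suff: generically A (fun x => forall i, i \in enum I -> P i x).
  by apply: genericallyW => x Px i; apply: Px; rewrite mem_enum.
elim: (enum I) => [|i s IHs].
  by exists (fun=> True); split=> //; [exact: zopenT | have [] := irrA].
apply: genericallyW (generically_and (gP i) IHs) => x [Pix Px] j.
by rewrite inE => /predU1P[->|/Px].
Qed.

Lemma generically_preim (Y : Type) (B : atlas K Y) (F : Y -> option X) (P : X -> Prop) :
  is_rational B A F -> generically A (fun x => exists y, F y = Some x) -> generically A P ->
  generically B (fun y => exists2 x, F y = Some x & P x).
Proof.
move=> [_ ratF] domF [U [opU neU UP]]; have gU : generically A U by exists U.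
have [x [Ux [y Fy]]] := generically_exists (generically_and gU domF).
have [opFU _] := ratF U opU; exists (preim_opt F U); split=> //; first by exists y, x.
by move=> z [w Fz /UP Pw]; exists w.
Qed.

End Generic.

(** * The Grassmannian *)

Lemma col_matrixP (R : Type) m p (A B : 'M[R]_(m, p)) : (forall j, col j A = col j B) <-> A = B.
Proof.
split=> [AB|-> //]; apply/trmx_inj/row_matrixP => j.
by rewrite -!tr_col AB.
Qed.

Lemma col_mul (R : pzRingType) m p q (A : 'M[R]_(m, p)) (B : 'M[R]_(p, q)) j :
  col j (A *m B) = A *m col j B.
Proof. by rewrite !colE mulmxA. Qed.

(* [k = k'.+1]: for [k = 0] the zero matrix that [rows_mx] returns on a set of the wrong size
   would have determinant [1]. *)
Section Grassmannian.
Variables (K : fieldType) (k' n : nat).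
Local Notation k := k'.+1.
Implicit Types (B : 'M[K]_(n, k)) (M : Gr K k n) (J : {set 'I_n}).

Lemma maxminorE B J : maxminor B J = \det (rows_mx B J).
Proof. by rewrite /maxminor /rows_mx; case: eqP; rewrite ?det0. Qed.

Lemma maxminor_neq0 B J : (maxminor B J != 0) = (rows_mx B J \in unitmx).
Proof. by rewrite maxminorE unitmxE unitfE. Qed.

Lemma rows_mxM B J (g : 'M_k) : rows_mx (B *m g) J = rows_mx B J *m g.
Proof. by rewrite /rows_mx; case: eqP => [e|_]; rewrite ?mul_rowsub_mx ?mul0mx. Qed.

Lemma maxminorM B J (g : 'M_k) : maxminor (B *m g) J = maxminor B J * \det g.
Proof. by rewrite !maxminorE rows_mxM det_mulmx. Qed.

Lemma entries_in_rows_mx (T : Type) (S : function_ring K T) (h : T -> 'M[K]_(n, k)) J :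
  entries_in S h -> entries_in S (fun x => rows_mx (h x) J).
Proof.
move=> Sh i j; rewrite /rows_mx; case: eqP => [e|_]; last exact: entries_in_cst.
by apply: fring_ext (Sh _ _) => x; rewrite mxE.
Qed.

Lemma gr_mx_basis M : exists2 X : k.-tuple 'cV[K]_n,
  basis_of (val M) X & gr_mx M = \matrix_(r < n, j < k) X`_j r 0.
Proof.
case: M => V dV; rewrite /gr_mx /=; have := vbasisP V.
by move: (vbasis V); rewrite (eqP dV) => X bX; exists X.
Qed.

Lemma mulmx_of_tuple (X : k.-tuple 'cV[K]_n) (c : 'cV[K]_k) :
  (\matrix_(r < n, j < k) X`_j r 0) *m c = \sum_j c j 0 *: X`_j.
Proof.
apply/colP => r; rewrite mxE summxE; apply: eq_bigr => j _.
by rewrite !mxE mulrC.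
Qed.

Lemma mem_gr M v : v \in val M <-> exists c : 'cV[K]_k, v = gr_mx M *m c.
Proof.
have [X bX ->] := gr_mx_basis M; split=> [vM|[c ->]]; last first.
  rewrite mulmx_of_tuple memv_suml // => j _; apply: memvZ.
  by apply: (basis_mem bX); apply: mem_nth; rewrite size_tuple.
exists (\col_j coord X j v); rewrite mulmx_of_tuple [LHS](coord_basis bX vM).
by apply: eq_bigr => j _; rewrite mxE.
Qed.

Lemma gr_mx_full M : row_full (gr_mx M).
Proof.
have [X bX ->] := gr_mx_basis M; rewrite /row_full -mxrank_tr; apply: inj_row_free => v vX0.
have : (\matrix_(r < n, j < k) X`_j r 0) *m v^T = 0.
  by apply: trmx_inj; rewrite trmx_mul trmxK vX0 trmx0.
rewrite mulmx_of_tuple => vX; apply/rowP => j.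
by have := freeP (basis_free bX) (fun j => v^T j 0) vX j; rewrite !mxE.
Qed.

(* [gr_mx M] is an arbitrary choice; a matrix [B] that spans [M] can be chosen to vary regularly
   with [M]. *)
Definition spans M B : Prop := exists2 g, g \in unitmx & gr_mx M = B *m g.

Lemma spans_gr_mx M : spans M (gr_mx M).
Proof. by exists 1%:M; rewrite ?unitmx1 ?mulmx1. Qed.

Lemma spans_mulmx M B (h : 'M_k) : h \in unitmx -> spans M B -> spans M (B *m h).
Proof.
move=> hu [g gu MB]; exists (invmx h *m g); first by rewrite unitmx_mul unitmx_inv hu.
by rewrite MB mulmxA mulmxK.
Qed.

Lemma spans_mem M B v : spans M B -> v \in val M <-> exists c : 'cV[K]_k, v = B *m c.
Proof.
move=> [g gu MB]; rewrite mem_gr MB; split=> [[c ->]|[c ->]].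
  by exists (g *m c); rewrite mulmxA.
by exists (invmx g *m c); rewrite -mulmxA mulKVmx.
Qed.

Lemma mulmx_of_cols m (C : 'M[K]_(n, m)) B :
  (forall j, exists c : 'cV[K]_k, col j C = B *m c) -> exists g, C = B *m g.
Proof.
move=> /fin_all_exists[f fE]; exists (\matrix_(i, j) f j i 0).
apply/col_matrixP => j; rewrite fE col_mul; congr (_ *m _).
by apply/colP => i; rewrite !mxE.
Qed.

Lemma spans_of_mem M B :
  (forall v, v \in val M <-> exists c : 'cV[K]_k, v = B *m c) -> spans M B.
Proof.
move=> memM.
have [g MB] : exists g, gr_mx M = B *m g.
  apply: mulmx_of_cols => j; apply/memM/mem_gr.
  by exists (col j 1%:M); rewrite -col_mul mulmx1.
have [h BM] : exists h, B = gr_mx M *m h.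
  apply: mulmx_of_cols => j; apply/mem_gr/memM.
  by exists (col j 1%:M); rewrite -col_mul mulmx1.
exists g => //; have hg1 : h *m g = 1%:M.
  by apply: (row_full_inj (gr_mx_full M)); rewrite mulmxA -BM -MB mulmx1.
by case: (mulmx1_unit hg1).
Qed.

Lemma spans_inj M M' B : spans M B -> spans M' B -> M = M'.
Proof.
move=> sM sM'; apply/val_inj/vspaceP => v; apply/idP/idP => /spans_mem.
  by move/(_ _ sM)/(spans_mem v sM').
by move/(_ _ sM')/(spans_mem v sM).
Qed.

Lemma spans_gr_act (g : 'M_n) M B : g \in unitmx -> spans M B -> spans (gr_act g M) (g *m B).
Proof.
move=> gu sM; apply: spans_of_mem => v; rewrite gr_actE //; split.
  move=> /memv_imgP[w /(spans_mem w sM)[c ->] ->]; exists c.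
  by rewrite lfunE /= mulmxA.
move=> [c ->]; apply/memv_imgP; exists (B *m c); last by rewrite lfunE /= mulmxA.
by apply/(spans_mem _ sM); exists c.
Qed.

Definition col_span B : option (Gr K k n) :=
  insub (limg (linfun (mulmx B : 'cV[K]_k -> 'cV[K]_n))).

Lemma col_span_spans B M : col_span B = Some M -> spans M B.
Proof.
rewrite /col_span; case: insubP => // N _ NE [<-]; apply: spans_of_mem => v; rewrite NE; split.
  by move=> /memv_imgP[c _ ->]; exists c; rewrite lfunE.
by move=> [c ->]; apply/memv_imgP; exists c; rewrite ?memvf ?lfunE.
Qed.

Lemma col_span_Some B J : rows_mx B J \in unitmx -> exists M, col_span B = Some M.
Proof.
move=> BJ; rewrite /col_span; case: insubP => [M _ _|]; first by exists M.
rewrite limg_dim_eq ?dimvf /dim /= ?muln1 ?eqxx //.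
apply/eqP; rewrite -subv0; apply/subvP=> c.
rewrite memv_cap memv_ker lfunE /= => /andP[_ /eqP Bc].
rewrite memv0 -(mulKmx BJ c); apply/eqP.
suff -> : rows_mx B J *m c = 0 by rewrite mulmx0.
rewrite /rows_mx; case: eqP => [e|_]; rewrite ?mul0mx // mul_rowsub_mx Bc.
by apply/matrixP => i j; rewrite !mxE.
Qed.

Lemma spans_maxminor_neq0 M B J :
  spans M B -> (maxminor (gr_mx M) J != 0) = (rows_mx B J \in unitmx).
Proof. by move=> [g gu ->]; rewrite maxminor_neq0 rows_mxM unitmx_mul gu andbT. Qed.

Lemma plucker_neq0 M B (I : seq int) :
  spans M B -> (plucker I M != 0) = (maxminor B (residues n I) != 0).
Proof. by move=> sM; rewrite /plucker (spans_maxminor_neq0 _ sM) maxminor_neq0. Qed.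

Lemma plucker_ratio M B (I J : seq int) : spans M B ->
  plucker I M / plucker J M = maxminor B (residues n I) / maxminor B (residues n J).
Proof.
move=> [g gu MB]; rewrite /plucker MB !maxminorM -mulf_div divff ?mulr1 //.
by rewrite -unitfE -unitmxE.
Qed.

Lemma maxminor_neq0_cover M : exists J, maxminor (gr_mx M) J != 0.
Proof.
pose f := fullrankfun (gr_mx_full M); exists [set f i | i : 'I_k].
rewrite maxminor_neq0 -row_full_unit.
have cardJ : #|[set f i | i : 'I_k]| = k.
  by rewrite card_imset ?card_ord //; apply: fullrankfun_inj.
have := fullrowsub_full (gr_mx_full M); rewrite -!sub1mx => /submx_trans; apply.
apply/row_subP => i; rewrite /rows_mx; case: eqP => // e.
have fJ : f i \in [set f i | i : 'I_k] by apply: imset_f.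
have -> : row i (rowsub f (gr_mx M)) =
  row (cast_ord e (enum_rank_in fJ (f i)))
    (rowsub (fun a : 'I_k => enum_val (cast_ord (esym e) a)) (gr_mx M)).
  by rewrite !row_rowsub cast_ordK enum_rankK_in.
exact: row_sub.
Qed.

Lemma maxminor_neq0_exists J : #|J| = k -> exists M, maxminor (gr_mx M) J != 0.
Proof.
move=> cardJ; pose B : 'M[K]_(n, k) := \matrix_(r, j) (if #|J| =P k is ReflectT e then
   (r == enum_val (cast_ord (esym e) j))%:R else 0).
have BJ : rows_mx B J \in unitmx.
  suff -> : rows_mx B J = 1%:M by exact: unitmx1.
  rewrite /rows_mx /B; case: eqP => // e; apply/matrixP => i j; rewrite !mxE.
  by rewrite (inj_eq enum_val_inj) (inj_eq (@cast_ord_inj _ _ _)).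
have [M /col_span_spans sM] := col_span_Some BJ.
by exists M; rewrite (spans_maxminor_neq0 _ sM).
Qed.

Definition chart_mx J M : 'M[K]_(n, k) := gr_mx M *m invmx (rows_mx (gr_mx M) J).

Lemma chart_mxE M B J : spans M B -> rows_mx B J \in unitmx ->
  chart_mx J M = B *m invmx (rows_mx B J).
Proof.
move=> [g gu MB] BJ; have RJ : rows_mx (gr_mx M) J \in unitmx.
  by rewrite MB rows_mxM unitmx_mul BJ.
rewrite /chart_mx -[RHS](mulmxK RJ); congr (_ *m _).
by rewrite {2}MB rows_mxM mulmxA mulmxKV // MB.
Qed.

Lemma spans_chart_mx M J : maxminor (gr_mx M) J != 0 -> spans M (chart_mx J M).
Proof.
by rewrite maxminor_neq0 -unitmx_inv => MJ; apply: spans_mulmx (spans_gr_mx M).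
Qed.

Lemma rows_chart_mx M J : maxminor (gr_mx M) J != 0 -> rows_mx (chart_mx J M) J = 1%:M.
Proof. by rewrite maxminor_neq0 => MJ; rewrite rows_mxM mulmxV. Qed.

Lemma rows_mx_eq1_chart J B : rows_mx B J = 1%:M ->
  exists M, [/\ spans M B, maxminor (gr_mx M) J != 0 & chart_mx J M = B].
Proof.
move=> BJ1; have BJ : rows_mx B J \in unitmx by rewrite BJ1 unitmx1.
have [M /col_span_spans sM] := col_span_Some BJ; exists M; split=> //.
  by rewrite (spans_maxminor_neq0 _ sM).
by rewrite (chart_mxE sM BJ) BJ1 invmx1 mulmx1.
Qed.

Local Notation GrA := (Gr_atlas K k n).

Lemma entries_in_chart_mx J M : entries_in (regular_in (J : chart_idx GrA) M) (chart_mx J).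
Proof.
move=> i j; apply: fring_ext (@entries_in_chart _ _ GrA J M 0 (mxvec_index i j)) => N.
exact: mxvecE.
Qed.

Lemma entries_in_rows_chart_mx J J' M :
  entries_in (regular_in (J : chart_idx GrA) M) (fun N => rows_mx (chart_mx J N) J').
Proof. exact: entries_in_rows_mx (entries_in_chart_mx J M). Qed.

Lemma Gr_affine J :
  algebraic_set (fun v => exists2 M, maxminor (gr_mx M) J != 0 & mxvec (chart_mx J M) = v).
Proof.
have pv := entries_in_vec_mx (@polyfun_id K (n * k)).
have := algebraic_mx_eq (entries_in_rows_mx J pv) (entries_in_cst _ 1%:M).
apply: algebraic_set_ext => v; split=> [/rows_mx_eq1_chart[M [_ MJ ME]]|[M MJ <-]].
  by exists M; rewrite // ME vec_mxK.
by rewrite mxvecK rows_chart_mx.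
Qed.

Lemma Gr_dom_open J : zopen GrA (fun M => maxminor (gr_mx M) J != 0).
Proof.
apply/zopenP => J' M MJ'; rewrite (spans_maxminor_neq0 _ (spans_chart_mx MJ')) => MJ.
have nJ := near_in_unitmx (A := GrA) MJ' (entries_in_rows_chart_mx J' J M) MJ.
apply: near_inW nJ => N NJ'.
by rewrite (spans_maxminor_neq0 _ (spans_chart_mx NJ')).
Qed.

Lemma Gr_transition J J' M : maxminor (gr_mx M) J != 0 -> maxminor (gr_mx M) J' != 0 ->
  entries_in (regular_in (J : chart_idx GrA) M)
    (fun N => chart_mx J N *m invmx (rows_mx (chart_mx J N) J')).
Proof.
move=> MJ; rewrite (spans_maxminor_neq0 _ (spans_chart_mx MJ)) => MJ'.
apply: entries_in_mulmx; first exact: entries_in_chart_mx.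
by apply: entries_in_invmx => //; apply: entries_in_rows_chart_mx.
Qed.

(* A pair [(v, w)] of matrices lies on the diagonal iff both have the identity in the rows of
   their chart and [v = w v_J']. *)
Lemma Gr_separated J J' :
  algebraic_set (fun v : 'rV[K]_(n * k + n * k) => exists M,
    [/\ maxminor (gr_mx M) J != 0, maxminor (gr_mx M) J' != 0
      & v = row_mx (mxvec (chart_mx J M)) (mxvec (chart_mx J' M))]).
Proof.
have pid := @polyfun_id K (n * k + n * k).
have pl := entries_in_vec_mx (entries_in_lsubmx pid).
have pr := entries_in_vec_mx (entries_in_rsubmx pid).
have algl := algebraic_mx_eq (entries_in_rows_mx J pl) (entries_in_cst _ 1%:M).
have algr := algebraic_mx_eq (entries_in_rows_mx J' pr) (entries_in_cst _ 1%:M).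
have alglr := algebraic_mx_eq pl (entries_in_mulmx pr (entries_in_rows_mx J' pl)).
apply: algebraic_set_ext (algebraic_setI (algebraic_setI algl algr) alglr) => w; split.
  move=> [[/= l1 r1] lr]; have [M [sM MJ ME]] := rows_mx_eq1_chart l1.
  have uR : rows_mx (vec_mx (lsubmx w)) J' \in unitmx.
    by move: l1; rewrite {1}lr rows_mxM => /mulmx1C/mulmx1_unit[].
  exists M; split=> //; first by rewrite (spans_maxminor_neq0 _ sM).
  by rewrite ME (chart_mxE sM uR) {2}lr mulmxK // !vec_mxK hsubmxK.
move=> [M [MJ MJ' ->]]; rewrite row_mxKl row_mxKr !mxvecK !rows_chart_mx //; split=> //.
have sM := spans_chart_mx MJ; have uR : rows_mx (chart_mx J M) J' \in unitmx.
  by rewrite -(spans_maxminor_neq0 _ sM).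
by rewrite (chart_mxE sM uR) mulmxKV.
Qed.

Lemma Gr_variety : is_variety GrA.
Proof.
split.
- exact: maxminor_neq0_cover.
- move=> J M M' /= MJ M'J /(can_inj mxvecK) MM'.
  by apply: spans_inj (spans_chart_mx MJ) _; rewrite /chart_mx MM'; apply: spans_chart_mx.
- exact: Gr_affine.
- exact: Gr_dom_open.
- move=> J J' j M /= MJ MJ'.
  have [p [q [qM pq]]] := entries_in_mxvec (Gr_transition MJ MJ') 0 j.
  exists p, q; split=> // N NJ NJ' qN; rewrite -(pq N NJ qN); congr (mxvec _ 0 j).
  rewrite -/(chart_mx J' N) (chart_mxE (spans_chart_mx NJ)) //.
  by rewrite -(spans_maxminor_neq0 _ (spans_chart_mx NJ)).
- exact: Gr_separated.
Qed.

Local Notation XkA := (Xk_atlas K n k).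

Lemma Xk_variety : is_variety XkA.
Proof. exact: prod_variety Gr_variety (Gm_variety K). Qed.

Lemma Xk_eq (x y : Xk K n k) B : spans x.1 B -> spans y.1 B -> val x.2 = val y.2 -> x = y.
Proof.
by case: x y => [M t] [M' t'] /= sM sM' /val_inj ->; rewrite (spans_inj sM sM').
Qed.

Definition Xk_chart J : chart_idx XkA := (J, tt).

Lemma entries_in_Xk_chart_mx J (x : Xk K n k) :
  entries_in (regular_in (Xk_chart J) x) (fun y => chart_mx J y.1).
Proof. exact: (@entries_in_fst _ _ _ GrA (Gm_atlas K) J tt x) (entries_in_chart_mx J x.1). Qed.

Lemma regular_in_Xk_scalar J (x : Xk K n k) :
  regular_in (Xk_chart J) x (fun y => val y.2).
Proof. exact: (@regular_in_snd _ _ _ GrA (Gm_atlas K) J tt x) (regular_in_val_Gm x.2). Qed.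

Lemma rational_at_Xk (X : Type) (A : atlas K X) (a : chart_idx A) (x : X)
    (F : X -> option (Xk K n k)) (B : X -> 'M[K]_(n, k)) (t : X -> K) :
  chart_dom a x -> entries_in (regular_in a x) B -> regular_in a x t ->
  near_in a x (fun x' => exists2 y, F x' = Some y & spans y.1 (B x') /\ val y.2 = t x') ->
  rational_at XkA a x F.
Proof.
move=> ax rB rt nF; have [y Fx [sy ty]] := near_in_self ax nF.
have [J yJ] := maxminor_neq0_cover y.1; rewrite (spans_maxminor_neq0 _ sy) in yJ.
have rR := entries_in_rows_mx J rB; exists (Xk_chart J).
exists (fun x' => row_mx (mxvec (B x' *m invmx (rows_mx (B x') J)))
                         (row_with_inv ((t x')%:M : 'rV_1))); split.
  apply: entries_in_row_mx.
    by apply: entries_in_mxvec; apply: entries_in_mulmx => //; apply: entries_in_invmx.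
  apply: entries_in_row_with_inv => [//||i]; first exact: entries_in_scalar.
  by rewrite ord1 mxE eqxx -ty; apply: (valP y.2).
apply: near_inW (near_inI nF (near_in_unitmx ax rR yJ)) => x' _ [[y' Fx' [sy' ty']] uR].
exists y' => //; split; first by split; rewrite //= (spans_maxminor_neq0 _ sy').
by rewrite -ty' -Gm_chartE -(chart_mxE sy' uR).
Qed.

Lemma col_span_gr_mx M : col_span (gr_mx M) = Some M.
Proof.
have [J] := maxminor_neq0_cover M; rewrite maxminor_neq0 => /col_span_Some[N NM].
by rewrite NM (spans_inj (col_span_spans NM) (spans_gr_mx M)).
Qed.

Lemma Gr_inhabited : (k <= n)%N -> exists M : Gr K k n, True.
Proof.
move=> kn; have cardJ : #|[set widen_ord kn i | i : 'I_k]| = k.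
  by rewrite card_imset ?card_ord // => i j [/val_inj].
by have [M _] := maxminor_neq0_exists cardJ; exists M.
Qed.

Lemma Xk_rational_curve (x1 x2 : Xk K n k) : exists F : K -> option (Xk K n k),
  [/\ is_rational (line_atlas K) XkA F, F 0 = Some x1 & F 1 = Some x2].
Proof.
pose B s : 'M_(n, k) := (1 - s) *: gr_mx x1.1 + s *: gr_mx x2.1.
pose t s := (1 - s) * val x1.2 + s * val x2.2.
pose F s := if col_span (B s) is Some M then omap (pair M) (to_Gm (t s)) else None.
have F0 : F 0 = Some x1.
  rewrite /F /B /t subr0 scale1r scale0r mul1r mul0r !addr0 col_span_gr_mx /to_Gm valK.
  by case: (x1).
have F1 : F 1 = Some x2.
  rewrite /F /B /t subrr scale1r scale0r mul1r mul0r !add0r col_span_gr_mx /to_Gm valK.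
  by case: (x2).
exists F; split=> //.
apply: (is_rational_of_local (line_variety K) Xk_variety); first by exists 0, x1.
move=> [] s y _ Fs; have rs := regular_in_line_id s.
have r1s : regular_in (tt : chart_idx (line_atlas K)) s (fun s => 1 - s).
  exact: fring_sub (fring_cst 1) rs.
have rB : entries_in (regular_in (tt : chart_idx (line_atlas K)) s) B.
  by apply: entries_in_add; apply: entries_in_scale => //; apply: entries_in_cst.
have rt : regular_in (tt : chart_idx (line_atlas K)) s t.
  by apply: fring_add; apply: fring_mul => //; apply: fring_cst.
apply: (rational_at_Xk (B := B) (t := t)) => //; move: Fs; rewrite /F.
case BM: (col_span (B s)) => [M|//]; rewrite /to_Gm; case: insubP => // c ts _ _.
have [J] := maxminor_neq0_cover M; rewrite (spans_maxminor_neq0 _ (col_span_spans BM)) => BJ.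
have nJ := near_in_unitmx (A := line_atlas K) (a := tt) I (entries_in_rows_mx J rB) BJ.
apply: near_inW (near_inI nJ (regular_in_neq0 (A := line_atlas K) (a := tt) I rt ts)) => s' _.
move=> [/col_span_Some[M' M'B] ts']; exists (M', Sub (t s') ts'); rewrite /= ?M'B ?insubT //.
by split=> //; apply: col_span_spans.
Qed.

Lemma Xk_irreducible : infinite_type K -> (k <= n)%N -> irreducible_space XkA.
Proof.
move=> K_infinite kn; apply: (irreducible_of_rational_curves K_infinite).
  by have [M _] := Gr_inhabited kn; exists (M, gm1 K).
exact: Xk_rational_curve.
Qed.

End Grassmannian.

(** * Elementary matrices *)

Section ElementaryMatrices.
Variables (K : fieldType) (n : nat).
Implicit Types (i r : 'I_n) (a c : K).

Lemma row_xmx m i r c (B : 'M[K]_(n, m)) :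
  row r (xmx i c *m B) = row r B + (if r == ord_pred i then c else 0) *: row i B.
Proof.
rewrite /xmx mulmxDl mul1mx linearD /=; congr (_ + _).
rewrite -scalemxAl linearZ /= row_mul (rowE i B) scalemxAl scalemxAl; congr (_ *m _).
by apply/rowP => l; rewrite !mxE; case: eqP => _; rewrite ?mul0r ?mulr0.
Qed.

Lemma xmxD i a c : i != ord_pred i -> xmx i a *m xmx i c = xmx i (a + c) :> 'M[K]_n.
Proof.
move=> ip; rewrite /xmx mulmxDl mul1mx mulmxDr mulmx1 -scalemxAl -scalemxAr.
by rewrite mul_delta_mx_0 // !scaler0 addr0 -addrA -scalerDl (addrC c).
Qed.

Lemma xmx0 i : xmx i 0 = 1%:M :> 'M[K]_n.
Proof. by rewrite /xmx scale0r addr0. Qed.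

Lemma xmx_unit i a : i != ord_pred i -> xmx i a \in @unitmx K n.
Proof.
move=> ip; have /mulmx1_unit[] // : xmx i a *m xmx i (- a) = 1%:M.
by rewrite xmxD // subrr xmx0.
Qed.

Lemma xmx_comm i r a c : i != ord_pred r -> r != ord_pred i ->
  xmx i a *m xmx r c = xmx r c *m xmx i a.
Proof.
move=> ir ri; rewrite /xmx !(mulmxDl, mulmxDr, mul1mx, mulmx1, =^~ scalemxAl, =^~ scalemxAr).
by rewrite !mul_delta_mx_0 // !scaler0 !addr0 addrAC.
Qed.

Lemma xmx_braid i r (a1 a2 a3 b1 b2 b3 : K) :
  i != ord_pred i -> i = ord_pred r -> r != i -> r != ord_pred i ->
  a1 + a3 = b2 -> a2 = b1 + b3 -> a1 * a2 = b2 * b3 ->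
  xmx i a1 *m (xmx r a2 *m xmx i a3) = xmx r b1 *m (xmx i b2 *m xmx r b3).
Proof.
move=> ip ir ri rp <- -> aab.
rewrite /xmx -ir; set E := delta_mx _ i; set F := delta_mx i r.
have EE : E *m E = 0 by apply: mul_delta_mx_0.
have FF : F *m F = 0 by apply: mul_delta_mx_0.
have FE : F *m E = 0 by apply: mul_delta_mx_0.
rewrite !(mulmxDl, mulmxDr, mul1mx, mulmx1, =^~ scalemxAl, =^~ scalemxAr) !mulmxA.
rewrite EE FE FF -[E *m F *m E]mulmxA FE !(mul0mx, mulmx0, scaler0, addr0) !scalerA aab.
rewrite !scalerDl; move: (_ *: (E *m F)) (a1 *: E) (a3 *: E) (b1 *: F) (b3 *: F) => g e e' f f'.
by apply/matrixP => s l; rewrite !mxE; ring.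
Qed.

End ElementaryMatrices.

(* The parameters of the six factors of the braid relation, in terms of the minors [P1], [N1] and
   [P2], [N2] that define the two operators. *)
Lemma braid_parameters (K : fieldType) (P1 P2 N1 N2 R T c1 c2 : K)
    (a3 := (c2 - 1) * P1 / N1) (N2' := N2 + a3 * R) (a2 := (c1 * c2 - 1) * P2 / N2')
    (N1' := N1 + a2 * T) (a1 := (c1 - 1) * (c2 * P1) / N1')
    (b3 := (c1 - 1) * P2 / N2) (N1'' := N1 + b3 * T) (b2 := (c1 * c2 - 1) * P1 / N1'')
    (N2'' := N2 + b2 * R) (b1 := (c2 - 1) * (c1 * P2) / N2'') :
  N2 * N1 = R * P1 + P2 * T ->
  P1 != 0 -> N1 != 0 -> N2 != 0 -> c1 != 0 -> c2 != 0 ->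
  N2' != 0 -> N1' != 0 -> N1'' != 0 -> N2'' != 0 ->
  [/\ a1 + a3 = b2, a2 = b1 + b3 & a1 * a2 = b2 * b3].
Proof.
move=> rel P10 N10 N20 c10 c20; have RE : R = (N2 * N1 - P2 * T) / P1 by rewrite rel; field.
pose y := N2 * N1 + (c1 - 1) * (P2 * T); pose z := c2 * (N2 * N1) - (c2 - 1) * (P2 * T).
have N2'E : N2' = z / N1 by rewrite /N2' /a3 /z RE; field; rewrite N10 P10.
have N1''E : N1'' = y / N2 by rewrite /N1'' /b3 /y; field.
rewrite N2'E N1''E mulf_eq0 negb_or => /andP[z0 _].
have N1'E : N1' = N1 * c2 * y / z by rewrite /N1' /a2 N2'E /y /z; field; rewrite N10 -/z z0.
rewrite N1'E !mulf_eq0 !negb_or => /andP[/andP[_ y0] _] _.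
have N2''E : N2'' = c1 * N2 * z / y.
  by rewrite /N2'' /b2 N1''E RE /y /z; field; rewrite P10 N20 -/y y0.
move=> _; rewrite /a1 /a2 /b1 /b2 /a3 /b3 N2'E N1''E N1'E N2''E.
by split; rewrite /y /z; field; rewrite -/y -/z ?N10 ?N20 ?y0 ?z0 ?c10 ?c20.
Qed.

(** * Minors with cyclically ordered rows *)

Section IntegerResidues.
Variable n' : nat.
Local Notation n := n'.+1.
Implicit Types (m j q : int) (i : 'I_n).

Definition ordz m : 'I_n := inord `|(m %% n%:Z)%Z|%N.

Lemma ordz_modz m : (ordz m)%:Z = (m %% n%:Z)%Z.
Proof.
have m_ge0 : 0 <= (m %% n%:Z)%Z by rewrite modz_ge0.
by rewrite /ordz inordK ?gez0_abs // -ltz_nat gez0_abs // ltz_mod.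
Qed.

Lemma ordz_eq m j : (ordz m == ordz j) = (n%:Z %| m - j)%Z.
Proof. by rewrite -eqz_mod_dvd -!ordz_modz. Qed.

Lemma ordz_shift m q : ordz (m + q * n%:Z) = ordz m.
Proof. by apply/eqP; rewrite ordz_eq addrAC subrr add0r dvdz_mull. Qed.

Lemma ordz_ord i : ordz i%:Z = i.
Proof. by rewrite /ordz modz_small ?absz_nat ?inord_val // ltz_nat ltn_ord. Qed.

Lemma ordzS m : ordz (m + 1) = ordS (ordz m).
Proof.
apply/val_inj/eqP; rewrite /= -eqz_nat ordz_modz -modz_nat -[(ordz m).+1]addn1 PoszD.
by rewrite ordz_modz modzDml.
Qed.

Lemma ordzB1 m : ordz (m - 1) = ord_pred (ordz m).
Proof. by rewrite -[in RHS](subrK 1 m) ordzS ordSK. Qed.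

Lemma dvdz_ord i m : (n%:Z %| i%:Z - m)%Z = (i == ordz m).
Proof. by rewrite -ordz_eq ordz_ord. Qed.

Lemma ndvdz_small m : - n%:Z < m < n%:Z -> m != 0 -> ~~ (n%:Z %| m)%Z.
Proof.
move=> mn m0; rewrite dvdzE /= gtnNdvd ?absz_gt0 //; lia.
Qed.

Lemma eqn_dvdz i (d : nat) : (d < n)%N -> (i == d :> nat) = (n%:Z %| i%:Z - d%:Z)%Z.
Proof. by move=> dn; rewrite dvdz_ord (ordz_ord (Ordinal dn)) -val_eqE. Qed.

Lemma dvdz_ordS i : (n%:Z %| (ordS i)%:Z - (i%:Z + 1))%Z.
Proof. by rewrite dvdz_ord ordzS ordz_ord. Qed.

Lemma divz_pred m : (m %/ n%:Z)%Z = ((m - 1) %/ n%:Z)%Z + (ordz m == 0 :> nat)%:Z.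
Proof.
have := divz_eq m n%:Z; rewrite -ordz_modz; move: (m %/ n%:Z)%Z (ltn_ord (ordz m)) => q.
case: (nat_of_ord (ordz m)) => [|d] dn -> /=.
  rewrite (_ : _ - 1 = (q - 1) * n%:Z + n'%:Z); last by lia.
  by rewrite divzMDl // divz_small ?addr0 ?subrK //= ltz_nat.
rewrite (_ : _ - 1 = q * n%:Z + d%:Z); last by lia.
by rewrite divzMDl // divz_small ?addr0 //= ltz_nat ltnW.
Qed.

End IntegerResidues.

Lemma enum_imset_increasing p n (f : 'I_p -> 'I_n) :
  (forall a b : 'I_p, (a < b)%N -> (f a < f b)%N) ->
  enum [set f a | a : 'I_p] = [seq f a | a <- enum 'I_p].
Proof.
move=> f_incr; pose lt_ord d (x y : 'I_d) := (x < y)%N.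
have lt_trans d : transitive (@lt_ord d) by move=> y x z; apply: ltn_trans.
have enum_sorted d : sorted (@lt_ord d) (enum 'I_d).
  by have := iota_ltn_sorted 0 d; rewrite -val_enum_ord sorted_map.
apply: (irr_sorted_eq (lt_trans n)).
- by move=> x; rewrite /lt_ord ltnn.
- by rewrite /enum_mem -enumT; apply: (sorted_filter (lt_trans n)); apply: enum_sorted.
- by apply: homo_sorted (enum_sorted p) => a b; apply: f_incr.
by move=> r; rewrite mem_enum; apply/imsetP/mapP => -[a _ ->]; exists a; rewrite ?mem_enum.
Qed.

Lemma det_rotate_rows (R : comNzRingType) m (A A' : 'M[R]_m.+1) :
  row ord_max A' = row ord0 A ->
  (forall a, row (lift ord_max a) A' = row (lift ord0 a) A) ->
  \det A' = (-1) ^+ m * \det A.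
Proof.
move=> /rowP last_row other_rows.
rewrite (expand_det_row A' ord_max) (expand_det_row A ord0) big_distrr /=.
apply: eq_bigr => j _; have := last_row j; rewrite !mxE => ->.
rewrite [RHS]mulrCA; congr (_ * _); rewrite /cofactor /= add0n exprD -mulrA.
congr (_ * (_ * \det _)); apply/matrixP => r s; rewrite !mxE.
by have /rowP/(_ (lift j s)) := other_rows r; rewrite !mxE.
Qed.

Definition upd (w : nat -> int) (s : nat) (m : int) : nat -> int :=
  fun a => if a == s then m else w a.

Section CyclicMinors.
Variables (K : fieldType) (k' n' : nat).
Local Notation k := k'.+1.
Local Notation n := n'.+1.
Implicit Types (B : 'M[K]_(n, k)) (w : nat -> int) (m j q : int) (i r : 'I_n) (c : K).

Local Notation ordz := (@ordz n').

Definition twist : K := (-1) ^+ k'.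

Lemma twist_sqr : twist * twist = 1.
Proof. by rewrite -expr2 /twist sqrr_sign. Qed.

Lemma twist_neq0 : twist != 0.
Proof. by rewrite expf_neq0 // oppr_eq0 oner_neq0. Qed.

Lemma twist_expz_k q : (twist ^ q) ^+ k = 1.
Proof.
rewrite exprnP exprzAC -exprnP (_ : twist ^+ k = 1) ?exp1rz //.
by rewrite /twist -exprM -signr_odd oddM /=; case: (odd k').
Qed.

(* The rows of [B] numbered by all integers, so that [cyc_row B (m + n) = twist *: cyc_row B m].
   With this sign, moving the first entry [m] of an increasing sequence to its end as [m + n] does
   not change the determinant of the corresponding rows. *)
Definition cyc_row B m : 'rV[K]_k := twist ^ ((m - 1) %/ n%:Z)%Z *: row (ordz (m - 1)) B.

Lemma cyc_row_shift B m q : cyc_row B (m + q * n%:Z) = twist ^ q *: cyc_row B m.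
Proof.
rewrite /cyc_row addrAC ordz_shift (addrC (m - 1)) divzMDl //.
by rewrite expfzDr ?twist_neq0 // scalerA.
Qed.

Lemma cyc_row_ord B r : cyc_row B r.+1%:Z = row r B.
Proof.
rewrite /cyc_row (_ : r.+1%:Z - 1 = r%:Z); last by lia.
by rewrite ordz_ord divz_small ?expr0z ?scale1r //= ltz_nat ltn_ord.
Qed.

Definition cyc_mx B w : 'M[K]_k := \matrix_(a < k) cyc_row B (w a).
Definition cyc_det B w : K := \det (cyc_mx B w).

Lemma eq_cyc_det B w w' : (forall a, (a < k)%N -> w a = w' a) -> cyc_det B w = cyc_det B w'.
Proof. by move=> ww'; congr (\det _); apply/row_matrixP => a; rewrite !rowK ww'. Qed.

Lemma cyc_det_dup B w a b : (a < k)%N -> (b < k)%N -> a != b -> w a = w b -> cyc_det B w = 0.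
Proof.
move=> ak bk ab wab.
apply: (determinant_alternate (i1 := Ordinal ak) (i2 := Ordinal bk)) => // j.
by rewrite !mxE /= wab.
Qed.

Lemma cyc_det_shift B w q : cyc_det B (fun a => w a + q * n%:Z) = cyc_det B w.
Proof.
rewrite -[RHS]mul1r -(twist_expz_k q) -detZ; congr (\det _).
by apply/row_matrixP => a; rewrite linearZ /= !rowK cyc_row_shift.
Qed.

Lemma cyc_det_upd B w m (s : 'I_k) : cyc_det B (upd w s m) = (cyc_row B m *m \adj (cyc_mx B w)) 0 s.
Proof.
rewrite /cyc_det (expand_det_row _ s) mxE; apply: eq_bigr => j _.
rewrite [\adj _ _ _]mxE [cyc_mx _ _ s j]mxE /upd eqxx; congr (_ * _).
rewrite /cofactor; congr (_ * \det _); apply/matrixP => r c; rewrite !mxE.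
by rewrite (inj_eq val_inj) eq_sym (negPf (neq_lift _ _)).
Qed.

Lemma cyc_det_upd_shift B w m (s : 'I_k) :
  cyc_det B (upd w s (m + n%:Z)) = twist * cyc_det B (upd w s m).
Proof.
by rewrite !cyc_det_upd -[n%:Z]mul1r cyc_row_shift expr1z -scalemxAl [LHS]mxE.
Qed.

(* Cramer's rule [det(W) x = sum_r det(W with row r replaced by x) W_r], to which the linear form
   [x |-> det(W' with row s replaced by x)] is applied. *)
Lemma cyc_det_exchange B w w' m (s : 'I_k) :
  cyc_det B w * cyc_det B (upd w' s m) =
  \sum_(r < k) cyc_det B (upd w r m) * cyc_det B (upd w' s (w r)).
Proof.
rewrite cyc_det_upd.
have -> : cyc_det B w * (cyc_row B m *m \adj (cyc_mx B w')) 0 s =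
    (cyc_row B m *m \adj (cyc_mx B w) *m (cyc_mx B w *m \adj (cyc_mx B w'))) 0 s.
  move: (cyc_row B m) => x.
  by rewrite mulmxA -(mulmxA _ (\adj _)) mul_adj_mx mul_mx_scalar -scalemxAl [RHS]mxE.
rewrite mxE; apply: eq_bigr => r _; rewrite !cyc_det_upd; congr (_ * _).
by rewrite [RHS]mxE mxE; apply: eq_bigr => j _; rewrite [cyc_mx _ _ _ _]mxE.
Qed.

Lemma cyc_det_last_to_first B w m :
  cyc_det B (upd w k' m) = twist * cyc_det B (fun a => if a is a'.+1 then w a' else m).
Proof.
apply: det_rotate_rows => [|a]; rewrite !rowK /upd /= ?eqxx //.
have ak := ltn_ord a; rewrite /bump leqNgt ak add0n.
by rewrite (ltn_eqF ak).
Qed.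

Lemma fring_cyc_det (T : Type) (S : function_ring K T) (h : T -> 'M[K]_(n, k)) w :
  entries_in S h -> S (fun x => cyc_det (h x) w).
Proof.
move=> Sh; apply: fring_det => a j.
by apply: fring_ext (fring_mul (fring_cst _) (Sh _ j)) => x; rewrite !mxE.
Qed.

Definition cyclically_increasing w : Prop :=
  forall a b, (a < b < k)%N -> w a < w b < w a + n%:Z.

Definition rotate w : nat -> int := upd (fun a => w a.+1) k' (w 0%N + n%:Z).

Definition row_set w : {set 'I_n} := [set ordz (w a - 1) | a : 'I_k].

Lemma cyclically_increasing_ndvdz w a b : cyclically_increasing w ->
  (a < k)%N -> (b < k)%N -> a != b -> ~~ (n%:Z %| w a - w b)%Z.
Proof.
move=> w_incr ak bk ab; apply: ndvdz_small; case: (ltngtP a b) ab => // lt_ab _.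
- by have := w_incr a b; lia.
- by have := w_incr b a; lia.
- by have := w_incr a b; lia.
- by have := w_incr b a; lia.
Qed.

Lemma cyclically_increasing_rotate w :
  cyclically_increasing w -> cyclically_increasing (rotate w).
Proof.
move=> w_incr a b abk; rewrite /rotate /upd; have -> : (a == k') = false by lia.
have w0a : w 0%N < w a.+1 < w 0%N + n%:Z by apply: w_incr; lia.
case: eqP => [_|bk']; first by lia.
by apply: w_incr; lia.
Qed.

Lemma cyc_det_rotate B w : cyc_det B (rotate w) = cyc_det B w.
Proof.
rewrite cyc_det_last_to_first -[RHS]mul1r -twist_sqr -mulrA; congr (_ * _).
rewrite (eq_cyc_det _ (w' := upd w (ord0 : 'I_k) (w 0%N + n%:Z))) => [|[]//].
by rewrite cyc_det_upd_shift; congr (_ * _); apply: eq_cyc_det => -[].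
Qed.

Lemma row_set_rotate w : row_set (rotate w) = row_set w.
Proof.
have ordD m : ordz (m + n%:Z - 1) = ordz (m - 1) by rewrite addrAC -[n%:Z]mul1r ordz_shift.
apply/setP => r; apply/imsetP/imsetP => -[a _ ->]; rewrite /rotate /upd.
  case: eqP => [_|ak]; first by exists ord0; rewrite ?ordD.
  have a1k : (a.+1 < k)%N by have := ltn_ord a; lia.
  by exists (Ordinal a1k).
case: a => -[|a] ak /=; first by exists ord_max; rewrite //= eqxx ordD.
exists (Ordinal (ltnW ak)); rewrite //=.
by have -> : (a == k') = false by lia.
Qed.

Lemma card_row_set w : cyclically_increasing w -> #|row_set w| = k.
Proof.
move=> w_incr; rewrite card_imset ?card_ord //.
move=> a b /eqP; rewrite ordz_eq (_ : _ - _ = w a - w b); last by ring.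
by apply: contraTeq; apply: cyclically_increasing_ndvdz (ltn_ord a) (ltn_ord b).
Qed.

Lemma maxminor_row_set_pos B w : cyclically_increasing w ->
  0 < w 0%N -> w k' <= n%:Z -> maxminor B (row_set w) = cyc_det B w.
Proof.
move=> w_incr w0 wk; have w_bnd (a : 'I_k) : 0 < w a <= n%:Z.
  have ak := ltn_ord a; apply/andP; split.
    by have [->|a0] := posnP a; last by have := w_incr 0%N a; lia.
  by have [->|ak'] := eqVneq (a : nat) k'; last by have := w_incr a k'; lia.
have wE (a : 'I_k) : w a = (ordz (w a - 1)).+1%:Z.
  rewrite [RHS]intS ordz_modz modz_small; first by rewrite addrC subrK.
  by have := w_bnd a; lia.
have f_incr (a b : 'I_k) : (a < b)%N -> (ordz (w a - 1) < ordz (w b - 1))%N.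
  by move=> ab; have := w_incr a b; rewrite ab ltn_ord => /(_ isT); have := wE a; have := wE b; lia.
rewrite maxminorE /rows_mx; case: eqP => [e|]; last by rewrite card_row_set.
congr (\det _); apply/row_matrixP => a; rewrite row_rowsub rowK wE cyc_row_ord; congr (row _ B).
rewrite (enum_val_nth (ordz (w a - 1))) (enum_imset_increasing f_incr).
by rewrite (nth_map a) ?size_enum_ord ?(ltn_ord a) // nth_ord_enum.
Qed.

(* The nonpositive entries are rotated to the end one by one. *)
Lemma maxminor_row_set_bounded B w : cyclically_increasing w ->
  - n%:Z < w 0%N -> w k' <= n%:Z -> maxminor B (row_set w) = cyc_det B w.
Proof.
have [N Nk] : exists N, (k <= N)%N by exists k.
have : forall a, (N <= a < k)%N -> 0 < w a by lia.
elim: N {Nk} w => [|N IHN] w w_pos w_incr w0 wk.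
  by apply: maxminor_row_set_pos => //; apply: w_pos.
have [w0_pos|w0_le0] := ltrP 0 (w 0%N); first exact: maxminor_row_set_pos.
have w0_lt a : (0 < a < k)%N -> w 0%N < w a by move=> /w_incr/andP[].
rewrite -row_set_rotate -cyc_det_rotate IHN //.
- by move=> a ak; rewrite /rotate /upd; case: eqP => [_|ak']; [lia | apply: w_pos; lia].
- exact: cyclically_increasing_rotate.
- rewrite /rotate /upd; case: eqP => [_|k0]; first by lia.
  by have := w0_lt 1%N; lia.
- by rewrite /rotate /upd eqxx; lia.
Qed.

Lemma maxminor_row_set B w :
  cyclically_increasing w -> maxminor B (row_set w) = cyc_det B w.
Proof.
move=> w_incr; pose q := ((- w 0%N) %/ n%:Z)%Z; pose w' a := w a + q * n%:Z.
have w'_incr : cyclically_increasing w' by move=> a b abk; have := w_incr a b abk; rewrite /w'; lia.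
have w'0 : - n%:Z < w' 0%N <= 0.
  have := divz_eq (- w 0%N) n%:Z; rewrite -/q /w'.
  have := modz_ge0 (- w 0%N) (isT : n%:Z != 0); have := ltz_mod (- w 0%N) (isT : n%:Z != 0).
  by move: (_ %% _)%Z => r; lia.
have w'k : w' k' <= n%:Z.
  by have := w'_incr 0%N k'; case: (posnP k') => [->|k0]; lia.
rewrite -(cyc_det_shift B w q) -maxminor_row_set_bounded -/w' //; last by lia.
by congr (maxminor B _); apply: eq_imset => a; rewrite addrAC ordz_shift.
Qed.

Lemma residues_mkseq w : residues n (mkseq w k) = row_set w.
Proof.
apply/setP => r; rewrite inE has_map.
have memE m : (r.+1%:Z == m %[mod n%:Z])%Z = (r == ordz (m - 1)).
  by rewrite eqz_mod_dvd -dvdz_ord; congr (_ %| _)%Z; lia.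
apply/hasP/imsetP => [[a]|[a _ ra]].
  by rewrite mem_iota add0n => /= ak; rewrite memE => /eqP ->; exists (Ordinal ak).
by exists (val a); rewrite ?mem_iota ?add0n ?ltn_ord //= memE ra.
Qed.

Lemma maxminor_residues B w :
  cyclically_increasing w -> maxminor B (residues n (mkseq w k)) = cyc_det B w.
Proof. by rewrite residues_mkseq; apply: maxminor_row_set. Qed.

(** * Row operations on the minors of almost consecutive rows *)

(* The cyclically increasing sequences of [j-k+1, j], [j-k+1, j-1] U {j+1} and
   {j-k} U [j-k+2, j]. *)
Definition window j : nat -> int := fun a => j - k'%:Z + a%:Z.
Definition raised_window j : nat -> int := upd (window j) k' (j + 1).
Definition lowered_window j : nat -> int := upd (window j) 0 (j - k%:Z).

Definition window_minor B j : K := cyc_det B (window j).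
Definition raised_minor B j : K := cyc_det B (raised_window j).
Definition lowered_minor B j : K := cyc_det B (lowered_window j).

(* The minors of [j-k+2, j-1] U {j+1, j+2}, of [j-k+1, j-1] U {j+2} and of
   {j-k} U [j-k+2, j-1] U {j+1}; for [k = 1] the first and the last set do not exist. *)
Definition raised_pair_minor B j : K :=
  if k' == 0 then 0 else cyc_det B (upd (raised_window (j + 1)) k'.-1 (j + 1)).
Definition twice_raised_minor B j : K := cyc_det B (upd (window j) k' (j + 2)).
Definition lowered_raised_minor B j : K :=
  if k' == 0 then 0 else cyc_det B (upd (lowered_window j) k' (j + 1)).

Local Notation P := window_minor.
Local Notation N := raised_minor.
Local Notation Q := lowered_minor.
Local Notation R := raised_pair_minor.
Local Notation T := twice_raised_minor.
Local Notation S := lowered_raised_minor.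

Lemma zint_mkseq (a b : int) (d : nat) :
  b = a + d%:Z - 1 -> zint a b = mkseq (fun l => a + l%:Z) d.
Proof.
move=> ->; rewrite /zint /mkseq; congr (map _ (iota 0 _)); case: d => [|d].
  by have -> : (a <= a + 0%N%:Z - 1) = false by lia.
have -> : a <= a + d.+1%:Z - 1 by lia.
by rewrite (_ : a + d.+1%:Z - 1 - a = d%:Z) //; lia.
Qed.

Lemma zint_window j : zint (j - k%:Z + 1) j = mkseq (window j) k.
Proof.
rewrite (@zint_mkseq _ _ k); last by lia.
by apply: eq_map => l; rewrite /window; lia.
Qed.

Lemma zint_raised_window j :
  rcons (zint (j - k%:Z + 1) (j - 1)) (j + 1) = mkseq (raised_window j) k.
Proof.
rewrite (@zint_mkseq _ _ k'); last by lia.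
rewrite mkseqS; congr rcons; last by rewrite /raised_window /upd eqxx.
apply/eq_in_map => l; rewrite mem_iota /raised_window /upd /window => lk.
by (have -> : (l == k') = false by lia); lia.
Qed.

Lemma zint_lowered_window j :
  (j - k%:Z) :: zint (j - k%:Z + 2) j = mkseq (lowered_window j) k.
Proof.
rewrite (@zint_mkseq _ _ k'); last by lia.
rewrite /mkseq /= -[1%N]addn0 iotaDl -map_comp; congr cons.
by apply: eq_map => l; rewrite /lowered_window /upd /window /=; lia.
Qed.

Hypothesis k_lt_n : (k < n)%N.

Lemma ndvdz_succ m : ~~ (n%:Z %| m + 1 - m)%Z.
Proof. by apply: ndvdz_small; lia. Qed.

Lemma ndvdz_pred m : ~~ (n%:Z %| m - 1 - m)%Z.
Proof. by apply: ndvdz_small; lia. Qed.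

Lemma ndvdz_width : ~~ (n%:Z %| k%:Z)%Z.
Proof. by apply: ndvdz_small; lia. Qed.

Lemma window_increasing j : cyclically_increasing (window j).
Proof. by move=> a b abk; rewrite /window; lia. Qed.

Lemma raised_window_increasing j : cyclically_increasing (raised_window j).
Proof.
move=> a b abk; rewrite /raised_window /upd /window.
by (have -> : (a == k') = false by lia); case: eqP; lia.
Qed.

Lemma lowered_window_increasing j : cyclically_increasing (lowered_window j).
Proof.
move=> a b abk; rewrite /lowered_window /upd /window.
by (have -> : (b == 0%N) = false by lia); case: eqP; lia.
Qed.

Lemma maxminor_window B j : maxminor B (residues n (zint (j - k%:Z + 1) j)) = P B j.
Proof. by rewrite zint_window; apply: maxminor_residues; apply: window_increasing. Qed.

Lemma maxminor_raised_window B j :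
  maxminor B (residues n (rcons (zint (j - k%:Z + 1) (j - 1)) (j + 1))) = N B j.
Proof.
by rewrite zint_raised_window; apply: maxminor_residues; apply: raised_window_increasing.
Qed.

Lemma maxminor_lowered_window B j :
  maxminor B (residues n ((j - k%:Z) :: zint (j - k%:Z + 2) j)) = Q B j.
Proof.
by rewrite zint_lowered_window; apply: maxminor_residues; apply: lowered_window_increasing.
Qed.

Lemma window_minor_eqmod B m j : (n%:Z %| m - j)%Z -> P B m = P B j.
Proof.
move=> /dvdzP[q mj]; rewrite /P -(cyc_det_shift B (window j) q); apply: eq_cyc_det => a _.
by rewrite /window; lia.
Qed.

Lemma raised_minor_eqmod B m j : (n%:Z %| m - j)%Z -> N B m = N B j.
Proof.
move=> /dvdzP[q mj]; rewrite /N -(cyc_det_shift B (raised_window j) q); apply: eq_cyc_det => a _.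
by rewrite /raised_window /upd /window; case: eqP => _; lia.
Qed.

Lemma lowered_minor_eqmod B m j : (n%:Z %| m - j)%Z -> Q B m = Q B j.
Proof.
move=> /dvdzP[q mj]; rewrite /Q -(cyc_det_shift B (lowered_window j) q); apply: eq_cyc_det => a _.
by rewrite /lowered_window /upd /window; case: eqP => _; lia.
Qed.

(* The sign by which [cyc_row] changes when the row [n] is followed by the row [n + 1]. *)
Definition wrap_sign j : K := if ordz j == 0 :> nat then twist else 1.

Definition cyc_xmx j c : 'M[K]_n := xmx (ordz j) (wrap_sign j * c).

Lemma cyc_row_xmx j c B m :
  cyc_row (cyc_xmx j c *m B) m =
    cyc_row B m + (if (n%:Z %| m - j)%Z then c else 0) *: cyc_row B (m + 1).
Proof.
rewrite {1}/cyc_row /cyc_xmx /wrap_sign row_xmx scalerDr -/(cyc_row B m); congr (_ + _).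
rewrite -ordzB1 ordz_eq (_ : m - 1 - (j - 1) = m - j); last by ring.
case: ifP => [mj|_]; last by rewrite !scale0r scaler0.
have -> : ordz j = ordz m by apply/eqP; rewrite eq_sym ordz_eq.
rewrite /cyc_row addrK !scalerA (divz_pred n' m) expfzDr ?twist_neq0 //; congr (_ *: _).
by case: eqP => _; rewrite ?expr1z ?expr0z; ring.
Qed.

Lemma cyc_det_xmx_none B j c w : (forall a, (a < k)%N -> ~~ (n%:Z %| w a - j)%Z) ->
  cyc_det (cyc_xmx j c *m B) w = cyc_det B w.
Proof.
move=> w_j; congr (\det _); apply/row_matrixP => a.
by rewrite !rowK cyc_row_xmx (negPf (w_j a _)) // scale0r addr0.
Qed.

Lemma cyc_det_xmx_at B j c w s : cyclically_increasing w -> (s < k)%N -> (n%:Z %| w s - j)%Z ->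
  cyc_det (cyc_xmx j c *m B) w = cyc_det B w + c * cyc_det B (upd w s (w s + 1)).
Proof.
move=> w_incr sk w_s; have w_other a : (a < k)%N -> a != s -> ~~ (n%:Z %| w a - j)%Z.
  move=> ak as_; apply: contra (cyclically_increasing_ndvdz w_incr ak sk as_) => w_a.
  by have := rpredB w_a w_s; rewrite opprB addrA subrK.
have lift_s a : (lift (Ordinal sk) a == s :> nat) = false.
  by rewrite -[s]/(nat_of_ord (Ordinal sk)) (inj_eq val_inj) eq_sym (negPf (neq_lift _ _)).
rewrite -[cyc_det B w]mul1r; apply: (determinant_multilinear (i0 := Ordinal sk)).
- by rewrite !rowK /upd /= eqxx scale1r cyc_row_xmx w_s.
- apply/row_matrixP => a; rewrite !row_rowsub !rowK cyc_row_xmx.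
  by rewrite (negPf (w_other _ _ _)) ?lift_s // scale0r addr0.
- apply/row_matrixP => a; rewrite !row_rowsub !rowK cyc_row_xmx /upd lift_s.
  by rewrite (negPf (w_other _ _ _)) ?lift_s // scale0r addr0.
Qed.

Lemma cyc_det_xmx_followed B j c w : cyclically_increasing w ->
  (forall s, (s < k)%N -> (n%:Z %| w s - j)%Z -> exists2 s', (s' < k)%N & w s' = w s + 1) ->
  cyc_det (cyc_xmx j c *m B) w = cyc_det B w.
Proof.
move=> w_incr followed; case: (pickP (fun s : 'I_k => (n%:Z %| w s - j)%Z)) => [s w_s|w_j].
  have [s' s'k w_s'] := followed s (ltn_ord s) w_s.
  have ss' : (s : nat) != s' by apply/eqP => eq_ss'; move: w_s'; rewrite -eq_ss'; lia.
  have dup0 : cyc_det B (upd w s (w s + 1)) = 0.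
    by apply: (cyc_det_dup B (ltn_ord s) s'k ss'); rewrite /upd eqxx eq_sym (negPf ss').
  by rewrite (cyc_det_xmx_at B c w_incr (ltn_ord s) w_s) dup0 mulr0 addr0.
by apply: cyc_det_xmx_none => a ak; apply/negbT/(w_j (Ordinal ak)).
Qed.

Lemma window_minor_xmx B j c : P (cyc_xmx j c *m B) j = P B j + c * N B j.
Proof.
have wk : window j k' = j by rewrite /window subrK.
by rewrite /P (@cyc_det_xmx_at _ _ _ _ k') ?wk ?subrr ?dvdz0 //; apply: window_increasing.
Qed.

Lemma window_minor_xmx_other B j c m : ~~ (n%:Z %| m - j)%Z -> P (cyc_xmx j c *m B) m = P B m.
Proof.
move=> mj; apply: cyc_det_xmx_followed => [|s sk]; first exact: window_increasing.
case: (eqVneq s k') mj => [->|sk' _ _]; first by rewrite /window subrK => /negPf ->.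
by exists s.+1; [lia | rewrite /window; lia].
Qed.

Lemma raised_minor_xmx_other B j c m :
  ~~ (n%:Z %| m + 1 - j)%Z -> ~~ (n%:Z %| j + 1 - m)%Z -> N (cyc_xmx j c *m B) m = N B m.
Proof.
move=> mj1 mj2; apply: cyc_det_xmx_followed => [|s sk]; first exact: raised_window_increasing.
rewrite /raised_window /upd; case: (eqVneq s k') => [_|sk']; first by rewrite (negPf mj1).
case: (eqVneq s.+1 k') mj2 => [sk1|sk1 _ _].
  have -> : window m s - j = - (j + 1 - m) by rewrite /window; lia.
  by rewrite rpredN => /negPf ->.
by exists s.+1; rewrite ?(negPf sk1) /window; lia.
Qed.

Lemma raised_minor_xmx B j c : N (cyc_xmx j c *m B) j = N B j.
Proof. by apply: raised_minor_xmx_other; apply: ndvdz_succ. Qed.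

Lemma raised_minor_xmx_pred B j c :
  N (cyc_xmx (j + 1) c *m B) j = N B j + c * T B j.
Proof.
have wk : raised_window j k' = j + 1 by rewrite /raised_window /upd eqxx.
rewrite /N (@cyc_det_xmx_at _ _ _ _ k') ?wk ?subrr ?dvdz0 //; last exact: raised_window_increasing.
congr (_ + _ * _); apply: eq_cyc_det => a _.
by rewrite /raised_window /upd; case: eqP; lia.
Qed.

Lemma raised_minor_xmx_succ B j c : (2 < n)%N ->
  N (cyc_xmx j c *m B) (j + 1) = N B (j + 1) + c * R B j.
Proof.
move=> n2; rewrite /R; case: eqP => k0.
  rewrite mulr0 addr0; apply: cyc_det_xmx_none => a ak.
  by apply: ndvdz_small; rewrite /raised_window /upd k0; (have -> : (a == 0%N) by lia); lia.
have wk1 : raised_window (j + 1) k'.-1 = j.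
  by rewrite /raised_window /upd /window; (have -> : (k'.-1 == k') = false by lia); lia.
rewrite /N (@cyc_det_xmx_at _ _ _ _ k'.-1) ?wk1 ?subrr ?dvdz0 //; last by lia.
exact: raised_window_increasing.
Qed.

Lemma twice_raised_minor_xmx B j c : (2 < n)%N -> T (cyc_xmx j c *m B) j = T B j.
Proof.
move=> n2; apply: cyc_det_xmx_none => a ak.
by apply: ndvdz_small; rewrite /upd /window; case: (a =P k'); lia.
Qed.

Lemma raised_pair_minor_xmx B j c : R (cyc_xmx (j + 1) c *m B) j = R B j.
Proof.
rewrite /R; case: eqP => // k0.
apply: cyc_det_xmx_followed => [a b abk|s sk].
  rewrite /upd /raised_window /upd /window; have -> : (a == k') = false by lia.
  by case: (a =P k'.-1) => ?; case: (b =P k'.-1) => ?; case: (b =P k') => ?; lia.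
rewrite /upd /raised_window /upd /window; case: eqP => [_ _|sk1].
  exists k' => //; have -> : (k' == k'.-1) = false by lia.
  by rewrite eqxx; lia.
by case: eqP => [_|sk2]; rewrite (negPf (ndvdz_small _ _)) //; lia.
Qed.

Lemma lowered_minor_xmx B j c : Q (cyc_xmx j c *m B) j = Q B j + c * S B j.
Proof.
rewrite /S; case: eqP => k0.
  rewrite mulr0 addr0; apply: cyc_det_xmx_none => a ak.
  by apply: ndvdz_small; rewrite /lowered_window /upd; (have -> : (a == 0%N) by lia); lia.
have wk : lowered_window j k' = j.
  by rewrite /lowered_window /upd /window; (have -> : (k' == 0%N) = false by lia); lia.
rewrite /Q (@cyc_det_xmx_at _ _ _ _ k') ?wk ?subrr ?dvdz0 //.
exact: lowered_window_increasing.
Qed.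

Lemma lowered_minor_xmx_first B j c m : (n%:Z %| m - k%:Z - j)%Z ->
  Q (cyc_xmx j c *m B) m = Q B m + c * P B m.
Proof.
move=> mj; rewrite /Q (@cyc_det_xmx_at _ _ _ _ 0%N) //; last exact: lowered_window_increasing.
congr (_ + _ * _); apply: eq_cyc_det => a _.
by rewrite /lowered_window /upd /window /=; case: eqP => [->|]; lia.
Qed.

Lemma lowered_minor_xmx_other B j c m :
  ~~ (n%:Z %| m - j)%Z -> ~~ (n%:Z %| m - k%:Z - j)%Z -> Q (cyc_xmx j c *m B) m = Q B m.
Proof.
move=> mj mkj; apply: cyc_det_xmx_followed => [|s sk]; first exact: lowered_window_increasing.
rewrite /lowered_window /upd; case: eqP => [_|s0]; first by rewrite (negPf mkj).
case: (eqVneq s k') => [->|sk' _]; first by rewrite /window subrK (negPf mj).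
by exists s.+1; [lia | rewrite /window /=; lia].
Qed.

Lemma plucker_raised_raised B j :
  N B (j + 1) * N B j = R B j * P B j + P B (j + 1) * T B j.
Proof.
rewrite [LHS](cyc_det_exchange B _ (window j) (j + 1) (ord_max : 'I_k)).
rewrite (bigD1 ord_max) //= addrC; congr (_ + _); last first.
  congr (_ * _); apply: eq_cyc_det => a _; rewrite /raised_window /upd /window ?eqxx;
    by case: eqP => // ?; lia.
rewrite /R; case: eqP => k0.
  rewrite mul0r big1 // => r; rewrite -val_eqE /= => rk.
  by have := ltn_ord r; lia.
have k1 : (k'.-1 < k)%N by lia.
have k1k : (k'.-1 == k') = false by lia.
rewrite (bigD1 (Ordinal k1)) -?val_eqE ?k1k //= big1 ?addr0 => [|r /andP[]].
  congr (_ * _); apply: eq_cyc_det => a _; rewrite /raised_window /upd /window k1k.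
  by case: eqP => [->|//]; lia.
rewrite -!val_eqE /= => rk rk1; have rk2 := ltn_ord r.
have -> : cyc_det B (upd (window j) k' (raised_window (j + 1) r)) = 0; last exact: mulr0.
apply: (@cyc_det_dup _ _ r.+1 k'); try lia.
rewrite /raised_window /upd /window eqxx (negPf rk).
by (have -> : (r.+1 == k') = false by lia); lia.
Qed.

Lemma plucker_lowered_raised B j :
  Q B j * N B j = S B j * P B j + P B (j - 1) * P B (j + 1).
Proof.
rewrite /S; case: eqP => k0.
  rewrite mul0r add0r /Q /N /P; congr (_ * _); apply: eq_cyc_det => a ak;
    by rewrite /lowered_window /raised_window /upd /window ?k0; (have -> : (a == 0%N) by lia); lia.
have k0k : (k' == 0%N) = false by lia.
rewrite [LHS](cyc_det_exchange B _ (window j) (j + 1) (ord_max : 'I_k)).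
rewrite (bigD1 ord_max) //=; congr (_ + _).
  congr (_ * _); apply: eq_cyc_det => a _; rewrite /lowered_window /upd /window k0k.
  by case: eqP => // ->; lia.
rewrite (bigD1 ord0) -?val_eqE 1?eq_sym ?k0k //= big1 ?addr0 => [|r /andP[]].
  have -> : cyc_det B (upd (window j) k' (lowered_window j 0)) = twist * P B (j - 1).
    rewrite cyc_det_last_to_first; congr (_ * _).
    by apply: eq_cyc_det => -[|a] _; rewrite /lowered_window /upd /window /=; lia.
  have -> : P B (j + 1) = twist * cyc_det B (upd (lowered_window j) 0 (j + 1)).
    transitivity (cyc_det B (upd (window (j + 1)) k' (j + 1))).
      by apply: eq_cyc_det => a _; rewrite /upd /window; case: eqP; lia.
    rewrite cyc_det_last_to_first; congr (_ * _).
    by apply: eq_cyc_det => -[|a] _; rewrite /lowered_window /upd /window /=; lia.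
  by ring.
rewrite -!val_eqE /= => rk r0; have rk1 := ltn_ord r.
have -> : cyc_det B (upd (window j) k' (lowered_window j r)) = 0; last exact: mulr0.
apply: (@cyc_det_dup _ _ r k'); try lia.
by rewrite /lowered_window /upd /window eqxx (negPf rk) (negPf r0).
Qed.

(** * The crystal structure on representing matrices *)

Lemma ordz_neqS j m : ~~ (n%:Z %| m + 1 - j)%Z -> ordz m != ord_pred (ordz j).
Proof. by rewrite -ordzB1 ordz_eq (_ : m - (j - 1) = m + 1 - j) //; ring. Qed.

Lemma cyc_xmx0 j : cyc_xmx j 0 = 1%:M.
Proof. by rewrite /cyc_xmx mulr0 xmx0. Qed.

Lemma cyc_xmx_unit j c : cyc_xmx j c \in unitmx.
Proof. by apply: xmx_unit; apply: ordz_neqS; apply: ndvdz_succ. Qed.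

Lemma cyc_xmxD j c d : cyc_xmx j c *m cyc_xmx j d = cyc_xmx j (c + d).
Proof. by rewrite /cyc_xmx xmxD -?mulrDr //; apply: ordz_neqS; apply: ndvdz_succ. Qed.

Lemma cyc_xmx_comm j m c d : ~~ (n%:Z %| m + 1 - j)%Z -> ~~ (n%:Z %| j + 1 - m)%Z ->
  cyc_xmx j c *m cyc_xmx m d = cyc_xmx m d *m cyc_xmx j c.
Proof. by move=> mj jm; apply: xmx_comm; apply: ordz_neqS. Qed.

Lemma cyc_xmx_braid j (a1 a2 a3 b1 b2 b3 : K) : (2 < n)%N ->
  a1 + a3 = b2 -> a2 = b1 + b3 -> a1 * a2 = b2 * b3 ->
  cyc_xmx j a1 *m (cyc_xmx (j + 1) a2 *m cyc_xmx j a3) =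
  cyc_xmx (j + 1) b1 *m (cyc_xmx j b2 *m cyc_xmx (j + 1) b3).
Proof.
move=> n2 <- -> aab; apply: xmx_braid.
- by apply: ordz_neqS; apply: ndvdz_succ.
- by rewrite -ordzB1 addrK.
- by rewrite ordz_eq ndvdz_succ.
- by apply: ordz_neqS; apply: ndvdz_small; lia.
- by rewrite mulrDr.
- by rewrite mulrDr.
- by rewrite mulrACA aab mulrACA.
Qed.

(* [e_j^c] on a representing matrix: in this numbering of the rows the powers of [t] cancel. *)
Definition e_coef B j c : K := (c - 1) * P B j / N B j.
Definition e_mx B j c : 'M[K]_(n, k) := cyc_xmx j (e_coef B j c) *m B.

Lemma e_mx_eqmod B m j c : (n%:Z %| m - j)%Z -> e_mx B m c = e_mx B j c.
Proof.
move=> mj; have ordE : ordz m = ordz j by apply/eqP; rewrite ordz_eq.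
rewrite /e_mx /cyc_xmx /wrap_sign /e_coef ordE.
by rewrite (window_minor_eqmod _ mj) (raised_minor_eqmod _ mj).
Qed.

Lemma window_minor_e_mx B j c : N B j != 0 -> P (e_mx B j c) j = c * P B j.
Proof. by move=> N0; rewrite window_minor_xmx /e_coef; field. Qed.

Lemma window_minor_e_mx_other B j c m : ~~ (n%:Z %| m - j)%Z -> P (e_mx B j c) m = P B m.
Proof. exact: window_minor_xmx_other. Qed.

Lemma raised_minor_e_mx B j c : N (e_mx B j c) j = N B j.
Proof. exact: raised_minor_xmx. Qed.

Lemma window_minor_e_mx_neq0 B j c : c != 0 -> N B j != 0 ->
  (forall m, P B m != 0) -> forall m, P (e_mx B j c) m != 0.
Proof.
move=> c0 N0 P0 m; have [mj|mj] := boolP (n%:Z %| m - j)%Z.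
  by rewrite (window_minor_eqmod _ mj) window_minor_e_mx // mulf_neq0.
by rewrite window_minor_e_mx_other.
Qed.

Lemma e_mx_1 B j : e_mx B j 1 = B.
Proof. by rewrite /e_mx /e_coef subrr !mul0r cyc_xmx0 mul1mx. Qed.

Lemma e_mxM B j c d : N B j != 0 -> e_mx (e_mx B j d) j c = e_mx B j (c * d).
Proof.
move=> N0; rewrite {1}/e_mx {2}/e_mx mulmxA cyc_xmxD; congr (cyc_xmx j _ *m B).
by rewrite {1}/e_coef window_minor_e_mx // raised_minor_e_mx /e_coef; field.
Qed.

Lemma e_mx_comm B j m c d :
  ~~ (n%:Z %| m - j)%Z -> ~~ (n%:Z %| m + 1 - j)%Z -> ~~ (n%:Z %| j + 1 - m)%Z ->
  e_mx (e_mx B m d) j c = e_mx (e_mx B j c) m d.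
Proof.
move=> mj m1j j1m; have jm : ~~ (n%:Z %| j - m)%Z by rewrite -rpredN opprB.
have coef_j : e_coef (e_mx B m d) j c = e_coef B j c.
  by rewrite /e_coef window_minor_e_mx_other // [N _ _]raised_minor_xmx_other.
have coef_m : e_coef (e_mx B j c) m d = e_coef B m d.
  by rewrite /e_coef window_minor_e_mx_other // [N _ _]raised_minor_xmx_other.
by rewrite {1}/e_mx {3}/e_mx coef_j coef_m /e_mx !mulmxA cyc_xmx_comm.
Qed.

Lemma e_mx_braid B j (c1 c2 : K) : (2 < n)%N ->
  c1 != 0 -> c2 != 0 -> P B j != 0 -> N B j != 0 -> N B (j + 1) != 0 ->
  N (e_mx B j c2) (j + 1) != 0 -> N (e_mx (e_mx B j c2) (j + 1) (c1 * c2)) j != 0 ->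
  N (e_mx B (j + 1) c1) j != 0 -> N (e_mx (e_mx B (j + 1) c1) j (c1 * c2)) (j + 1) != 0 ->
  e_mx (e_mx (e_mx B j c2) (j + 1) (c1 * c2)) j c1 =
  e_mx (e_mx (e_mx B (j + 1) c1) j (c1 * c2)) (j + 1) c2.
Proof.
move=> n2 c10 c20 P0 N0 N10.
have Pj C d : P (e_mx C (j + 1) d) j = P C j.
  by rewrite window_minor_e_mx_other // (_ : j - (j + 1) = j - 1 - j) ?ndvdz_pred //; ring.
have Pj1 C d : P (e_mx C j d) (j + 1) = P C (j + 1).
  by rewrite window_minor_e_mx_other // ndvdz_succ.
have Nj C d : N (e_mx C (j + 1) d) j = N C j + e_coef C (j + 1) d * T C j.
  exact: raised_minor_xmx_pred.
have Nj1 C d : N (e_mx C j d) (j + 1) = N C (j + 1) + e_coef C j d * R C j.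
  exact: raised_minor_xmx_succ.
have Rj C d : R (e_mx C (j + 1) d) j = R C j by apply: raised_pair_minor_xmx.
have Tj C d : T (e_mx C j d) j = T C j by apply: twice_raised_minor_xmx.
have a2E : e_coef (e_mx B j c2) (j + 1) (c1 * c2) =
    (c1 * c2 - 1) * P B (j + 1) / (N B (j + 1) + e_coef B j c2 * R B j).
  by rewrite {1}/e_coef Pj1 Nj1.
have b2E : e_coef (e_mx B (j + 1) c1) j (c1 * c2) =
    (c1 * c2 - 1) * P B j / (N B j + e_coef B (j + 1) c1 * T B j).
  by rewrite {1}/e_coef Pj Nj.
have a1E : e_coef (e_mx (e_mx B j c2) (j + 1) (c1 * c2)) j c1 = (c1 - 1) * (c2 * P B j) /
    (N B j + e_coef (e_mx B j c2) (j + 1) (c1 * c2) * T B j).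
  by rewrite {1}/e_coef Pj Nj window_minor_e_mx // raised_minor_e_mx Tj.
have b1E : e_coef (e_mx (e_mx B (j + 1) c1) j (c1 * c2)) (j + 1) c2 =
    (c2 - 1) * (c1 * P B (j + 1)) /
    (N B (j + 1) + e_coef (e_mx B (j + 1) c1) j (c1 * c2) * R B j).
  by rewrite {1}/e_coef Pj1 Nj1 window_minor_e_mx // raised_minor_e_mx Rj.
rewrite !Nj !Nj1 !raised_minor_e_mx Tj Rj a2E b2E => q1 p2 p1 q2.
have [] := braid_parameters (plucker_raised_raised B j) P0 N0 N10 c10 c20 q1 p2 p1 q2.
rewrite -a2E -b2E -a1E -b1E => ab1 ab2 ab3.
by rewrite /e_mx !mulmxA; congr (_ *m B); rewrite -!mulmxA; apply: cyc_xmx_braid.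
Qed.

Lemma ordS_neq i : ordS i != i.
Proof. by rewrite -[i in ordS i]ordz_ord -ordzS -(ordz_ord i) ordz_eq ordz_ord ndvdz_succ. Qed.

Lemma window_minor_ordz B m : P B (ordz m)%:Z = P B m.
Proof. by apply: window_minor_eqmod; rewrite dvdz_ord. Qed.

(* The functions [phi_i], [eps_i], [gamma_i] and [f] at the point [(M, t)], for a matrix [B] that
   spans [M]. The component [gamma_0] stands for [gamma_n]. *)
Definition phi_val (t : K) B i : K := t ^- (i == 0 :> nat) * (N B i%:Z / P B i%:Z).

Definition eps_val (t : K) B i : K :=
  t ^- (i == k :> nat) * (N B i%:Z * P B i%:Z / (P B (i%:Z - 1) * P B (i%:Z + 1))).

Definition gamma_weight (t : K) i : K := if (1 <= i <= k)%N then 1 else t.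

Definition gamma_val (t : K) B i : K := gamma_weight t i * (P B i%:Z / P B (i%:Z - 1)).

Definition f_term (t : K) B i : K := t ^+ (i == k :> nat) * (Q B i%:Z / P B i%:Z).

Definition f_val (t : K) B : K := \sum_i f_term t B i.

Lemma phi_val_neq0 (t : K) B i :
  t != 0 -> P B i%:Z != 0 -> N B i%:Z != 0 -> phi_val t B i != 0.
Proof. by move=> t0 P0 N0; rewrite !mulf_neq0 ?invr_eq0 ?expf_neq0. Qed.

Lemma gamma_weight_neq0 (t : K) i : t != 0 -> gamma_weight t i != 0.
Proof. by move=> t0; rewrite /gamma_weight; case: ifP => _; rewrite ?oner_neq0. Qed.

Section ValuesAtNonzeroMinors.
Variables (t : K) (B : 'M[K]_(n, k)) (i : 'I_n).
Hypotheses (t_neq0 : t != 0) (P_neq0 : forall m, P B m != 0).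

Lemma gamma_weight_ordS :
  t ^- (i == k :> nat) * gamma_weight t (ordS i) = t ^- (i == 0 :> nat) * gamma_weight t i.
Proof.
have ordSE : ordS i = i.+1 :> nat \/ ordS i = 0 :> nat /\ i.+1 = n.
  have := ltn_ord i; rewrite leq_eqVlt => /orP[/eqP iE|i1]; last by left; rewrite /= modn_small.
  by right; rewrite /= iE modnn.
rewrite /gamma_weight; move: (nat_of_ord (ordS i)) ordSE => s sE.
case: eqP => [ik|ik]; case: eqP => [i0|i0]; try lia.
- by rewrite ifF ?ifT ?expr0 ?expr1 ?invr1 ?mul1r ?mulVf //; lia.
- by rewrite ifT ?ifF ?expr0 ?expr1 ?invr1 ?mul1r ?mulVf //; lia.
- by have -> : (0 < s <= k)%N = (0 < i <= k)%N by lia.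
Qed.

Lemma eps_val_neq0 : N B i%:Z != 0 -> eps_val t B i != 0.
Proof. by move=> N0; rewrite !mulf_neq0 ?invr_eq0 ?expf_neq0 ?mulf_neq0. Qed.

Lemma gamma_val_neq0 : gamma_val t B i != 0.
Proof. by rewrite !mulf_neq0 ?invr_eq0 ?gamma_weight_neq0. Qed.

Lemma eps_val_phi_val :
  eps_val t B i = phi_val t B i * (gamma_val t B i / gamma_val t B (ordS i)).
Proof.
have PS : P B (ordS i)%:Z = P B (i%:Z + 1) by apply: window_minor_eqmod; apply: dvdz_ordS.
have Pi : P B ((ordS i)%:Z - 1) = P B i%:Z.
  apply: window_minor_eqmod; rewrite -[X in (_ %| X)%Z]addrA -opprD (addrC 1).
  exact: dvdz_ordS.
have wS0 := gamma_weight_neq0 (ordS i) t_neq0.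
rewrite /eps_val /phi_val /gamma_val PS Pi.
have -> : t ^- (i == k :> nat) =
    t ^- (i == 0 :> nat) * gamma_weight t i / gamma_weight t (ordS i).
  by rewrite -gamma_weight_ordS mulfK.
move: (t ^- _) => s; field.
by rewrite wS0 !P_neq0.
Qed.

Variable c : K.
Hypotheses (c_neq0 : c != 0) (N_neq0 : N B i%:Z != 0).

Lemma phi_val_e_mx : phi_val t (e_mx B i%:Z c) i = c^-1 * phi_val t B i.
Proof. by rewrite /phi_val window_minor_e_mx // raised_minor_e_mx invfM; ring. Qed.

Lemma eps_val_e_mx : eps_val t (e_mx B i%:Z c) i = c * eps_val t B i.
Proof.
rewrite /eps_val window_minor_e_mx // raised_minor_e_mx.
by rewrite !window_minor_e_mx_other ?ndvdz_succ ?ndvdz_pred //; ring.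
Qed.

Lemma window_minor_pred_e_mx r : P (e_mx B i%:Z c) (r%:Z - 1) =
  (if r == ordS i then c else 1) * P B (r%:Z - 1).
Proof.
have -> : (r == ordS i) = (n%:Z %| r%:Z - 1 - i%:Z)%Z.
  by rewrite -(ordz_ord i) -ordzS -dvdz_ord ordz_ord; congr (_ %| _)%Z; ring.
case: ifP => [ri|/negbT ri]; last by rewrite mul1r window_minor_e_mx_other.
by rewrite !(window_minor_eqmod _ ri) window_minor_e_mx.
Qed.

Lemma gamma_val_e_mx (g : Gm K) r : val g = c ->
  gamma_val t (e_mx B i%:Z c) r = alpha_vee i g r * gamma_val t B r.
Proof.
move=> gE; rewrite /gamma_val window_minor_pred_e_mx /alpha_vee gE.
have [->|ri] := eqVneq r i.
  by rewrite eq_sym (negPf (ordS_neq i)) window_minor_e_mx // mul1r; ring.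
rewrite window_minor_e_mx_other; last by rewrite dvdz_ord ordz_ord.
by case: ifP => _; [field; rewrite P_neq0 | rewrite !mul1r].
Qed.

Lemma f_term_e_mx_other r : r != i -> r != ordz (i%:Z + k%:Z) ->
  f_term t (e_mx B i%:Z c) r = f_term t B r.
Proof.
rewrite -{1}(ordz_ord i) -!dvdz_ord => ri rik; rewrite /f_term window_minor_e_mx_other //.
rewrite [Q _ _]lowered_minor_xmx_other //.
by apply: contra rik; rewrite addrAC -addrA -opprD.
Qed.

Lemma f_term_e_mx_add (r := ordz (i%:Z + k%:Z)) :
  f_term t (e_mx B i%:Z c) r = f_term t B r + (c - 1) / phi_val t B i.
Proof.
have rik : (n%:Z %| r%:Z - k%:Z - i%:Z)%Z by rewrite -addrA -opprD (addrC k%:Z) dvdz_ord.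
have ri : ~~ (n%:Z %| r%:Z - i%:Z)%Z.
  apply/negP => /rpredB/(_ rik); rewrite (_ : _ - _ = k%:Z); last by ring.
  by rewrite (negPf ndvdz_width).
have rk : (r == k :> nat) = (i == 0 :> nat).
  rewrite !eqn_dvdz // subr0; apply/idP/idP => [rk|i0].
    by have := rpredB rk rik; rewrite opprB addrC subrK.
  by have := rpredD rik i0; rewrite subrK.
rewrite /f_term window_minor_e_mx_other // [Q _ _]lowered_minor_xmx_first // rk /phi_val /e_coef.
by case: eqP => _; rewrite ?expr1 ?expr0; field; rewrite ?oner_neq0 N_neq0 !P_neq0 ?t_neq0.
Qed.

Lemma f_term_e_mx_self :
  f_term t (e_mx B i%:Z c) i = f_term t B i + (c^-1 - 1) / eps_val t B i.
Proof.
have SE : S B i%:Z = (Q B i%:Z * N B i%:Z - P B (i%:Z - 1) * P B (i%:Z + 1)) / P B i%:Z.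
  by rewrite plucker_lowered_raised addrK mulfK.
rewrite /f_term /eps_val window_minor_e_mx // [Q _ _]lowered_minor_xmx SE /e_coef.
by case: eqP => _; rewrite ?expr1 ?expr0; field; rewrite ?oner_neq0 N_neq0 !P_neq0 c_neq0 ?t_neq0.
Qed.

Lemma f_val_e_mx : f_val t (e_mx B i%:Z c) =
  f_val t B + (c - 1) / phi_val t B i + (c^-1 - 1) / eps_val t B i.
Proof.
have ki : ordz (i%:Z + k%:Z) != i.
  by rewrite eq_sym -dvdz_ord; apply: ndvdz_small; lia.
rewrite /f_val (bigD1 i) // (bigD1 (ordz (i%:Z + k%:Z))) //=.
rewrite [X in _ = X + _ + _](bigD1 i) // [X in _ = _ + X + _ + _](bigD1 (ordz (i%:Z + k%:Z))) //=.
rewrite f_term_e_mx_self f_term_e_mx_add.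
rewrite (eq_bigr (f_term t B)) => [|r /andP[ri rik]]; last exact: f_term_e_mx_other.
by ring.
Qed.

End ValuesAtNonzeroMinors.

(** * The crystal structure on the variety *)

Local Notation X := (Xk K n k).
Local Notation XA := (Xk_atlas K n k).
Implicit Types (x y : X) (g h : Gm K).

Lemma Xphi_spans x B i : spans x.1 B -> Xphi i x = to_Gm (phi_val (val x.2) B i).
Proof.
by move=> sx; rewrite /Xphi (plucker_ratio _ _ sx) maxminor_raised_window maxminor_window.
Qed.

Lemma Xeps_spans x B i : spans x.1 B -> Xeps i x = to_Gm (eps_val (val x.2) B i).
Proof.
move=> sx; rewrite /Xeps -!mulf_div !(plucker_ratio _ _ sx) !mulf_div.
have -> : zint (i%:Z - k%:Z) (i%:Z - 1) = zint (i%:Z - 1 - k%:Z + 1) (i%:Z - 1).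
  by congr zint; lia.
have -> : zint (i%:Z - k%:Z + 2) (i%:Z + 1) = zint (i%:Z + 1 - k%:Z + 1) (i%:Z + 1).
  by congr zint; lia.
by rewrite !maxminor_window maxminor_raised_window.
Qed.

Lemma Xgamma_spans x B : spans x.1 B ->
  Xgamma x = insub (\row_i gamma_val (val x.2) B i).
Proof.
move=> sx; rewrite /Xgamma; congr insub; apply/rowP => i; rewrite !mxE (plucker_ratio _ _ sx).
have -> : zint (i%:Z - k%:Z) (i%:Z - 1) = zint (i%:Z - 1 - k%:Z + 1) (i%:Z - 1).
  by congr zint; lia.
by rewrite !maxminor_window.
Qed.

Lemma Xf_value_spans x B : spans x.1 B -> Xf_value x = f_val (val x.2) B.
Proof.
move=> sx; pose term (r : nat) := (val x.2) ^+ (r == k :> nat) * (Q B r%:Z / P B r%:Z).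
have term_k :
    val x.2 * (plucker (rcons (zint 2 k%:Z) n%:Z) x.1 / plucker (zint 1 k%:Z) x.1) = term k.
  rewrite /term eqxx expr1 (plucker_ratio _ _ sx) -maxminor_lowered_window -maxminor_window.
  rewrite subrr add0r; congr (_ * (maxminor _ _ / _)); apply/setP => r.
  by rewrite !inE has_rcons /= modzz mod0z.
have term_n : term n = term 0.
  rewrite /term (_ : (n == k) = false) 1?(_ : (0 == k) = false) //; last by lia.
  by congr (_ * (_ / _)); [apply: lowered_minor_eqmod | apply: window_minor_eqmod];
    rewrite subr0 dvdzz.
rewrite /Xf_value term_k; transitivity (\sum_(1 <= r < n.+1) term r); last first.
  rewrite /f_val -(big_mkord xpredT term) [LHS]big_nat_recr //= [RHS]big_ltn //.
  by rewrite term_n addrC.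
rewrite [RHS](bigD1_seq k) ?iota_uniq ?mem_index_iota //=; last by lia.
rewrite [RHS]addrC; congr (_ + _); apply: eq_bigr => r rk.
by rewrite (plucker_ratio _ _ sx) /term (negPf rk) mul1r maxminor_window maxminor_lowered_window.
Qed.

Lemma Xf_spans x B : spans x.1 B -> (forall m, P B m != 0) ->
  Xf x = to_Gm (f_val (val x.2) B).
Proof.
move=> sx P0; rewrite /Xf (Xf_value_spans sx) ifT //; apply/forallP => i.
by rewrite (plucker_neq0 _ sx) maxminor_window.
Qed.

Lemma Xf_SomeP x B g : spans x.1 B -> Xf x = Some g ->
  (forall m, P B m != 0) /\ val g = f_val (val x.2) B.
Proof.
move=> sx; rewrite /Xf (Xf_value_spans sx); case: ifP => // /forallP P0 /to_GmP ->.
split=> // m; have := P0 (ordz m).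
by rewrite (plucker_neq0 _ sx) maxminor_window window_minor_ordz.
Qed.

Lemma Xphi_Some x B i : spans x.1 B -> P B i%:Z != 0 -> N B i%:Z != 0 ->
  exists2 g, Xphi i x = Some g & val g = phi_val (val x.2) B i.
Proof.
move=> sx P0 N0; rewrite (Xphi_spans _ sx); apply: to_Gm_Some.
exact: phi_val_neq0 (valP x.2) P0 N0.
Qed.

Lemma Xphi_SomeP x B i g : spans x.1 B -> Xphi i x = Some g ->
  P B i%:Z != 0 /\ N B i%:Z != 0.
Proof.
move=> sx; rewrite (Xphi_spans _ sx) => /to_GmP gE; have := valP g; rewrite gE.
by rewrite !mulf_eq0 !negb_or !invr_eq0 => /and3P[_ N0 P0].
Qed.

Lemma Xeps_Some x B i : spans x.1 B -> (forall m, P B m != 0) -> N B i%:Z != 0 ->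
  exists2 g, Xeps i x = Some g & val g = eps_val (val x.2) B i.
Proof.
move=> sx P0 N0; rewrite (Xeps_spans _ sx); apply: to_Gm_Some.
exact: eps_val_neq0 (valP x.2) P0 N0.
Qed.

Lemma Xgamma_Some x B : spans x.1 B -> (forall m, P B m != 0) ->
  exists2 z, Xgamma x = Some z & forall i, val z 0 i = gamma_val (val x.2) B i.
Proof.
move=> sx P0; rewrite (Xgamma_spans sx); set w := \row_i _.
have wP : [forall i, w 0 i != 0].
  by apply/forallP => i; rewrite mxE gamma_val_neq0 // (valP x.2).
by exists (exist _ w wP); [rewrite insubT | move=> i; rewrite mxE].
Qed.

Lemma XeE i g x B : spans x.1 B -> P B i%:Z != 0 -> N B i%:Z != 0 ->
  Xe i g x = Some (gr_act (cyc_xmx i%:Z (e_coef B i%:Z (val g))) x.1, x.2).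
Proof.
move=> sx P0 N0; have [v phix vE] := Xphi_Some sx P0 N0; have t0 := valP x.2.
rewrite /Xe phix vE /cyc_xmx /wrap_sign ordz_ord; congr (Some (gr_act (xmx i _) _, _)).
rewrite /phi_val /e_coef /twist; case: eqP => _ /=; rewrite ?expr1 ?expr0 ?invr1 ?mul1r; field.
  by rewrite t0 P0 N0.
by rewrite P0 N0.
Qed.

Lemma Xe_Some i g x B : spans x.1 B -> P B i%:Z != 0 -> N B i%:Z != 0 ->
  exists2 y, Xe i g x = Some y & spans y.1 (e_mx B i%:Z (val g)) /\ val y.2 = val x.2.
Proof.
move=> sx P0 N0; rewrite (XeE _ sx P0 N0); eexists; first reflexivity.
by split=> //=; apply: spans_gr_act => //; apply: cyc_xmx_unit.
Qed.

Lemma Xe_SomeP i g x y B : spans x.1 B -> Xe i g x = Some y ->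
  [/\ P B i%:Z != 0, N B i%:Z != 0, spans y.1 (e_mx B i%:Z (val g)) & val y.2 = val x.2].
Proof.
move=> sx ex; have [v phix] : exists v, Xphi i x = Some v.
  by move: ex; rewrite /Xe; case: (Xphi i x) => // v _; exists v.
have [P0 N0] := Xphi_SomeP sx phix; have [y' ey' [sy' ty']] := Xe_Some g sx P0 N0.
by move: ex; rewrite ey' => -[<-].
Qed.

Lemma Xe_mul i g1 g2 x v : Xphi i x = Some v ->
  obind (Xe i g1) (Xe i g2 x) = Xe i (gm_mul g1 g2) x.
Proof.
have sx := spans_gr_mx x.1 => /(Xphi_SomeP sx)[P0 N0].
have [y -> [sy ty]] := Xe_Some g2 sx P0 N0.
have [||z ez [sz tz]] := Xe_Some (i := i) g1 sy.
- by rewrite window_minor_e_mx // mulf_neq0 // (valP g2).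
- by rewrite raised_minor_e_mx.
have [z' -> [sz' tz']] := Xe_Some (gm_mul g1 g2) sx P0 N0.
rewrite e_mxM // in sz.
by rewrite /= ez; congr Some; apply: Xk_eq sz sz' _; rewrite tz ty tz'.
Qed.

Lemma Xe_1 i x v : Xphi i x = Some v -> Xe i (gm1 K) x = Some x.
Proof.
have sx := spans_gr_mx x.1 => /(Xphi_SomeP sx)[P0 N0].
have [y -> [sy ty]] := Xe_Some (gm1 K) sx P0 N0; rewrite e_mx_1 in sy.
by congr Some; apply: Xk_eq sy sx ty.
Qed.

Section RegularValues.
Variables (Y : Type) (A : atlas K Y) (a : chart_idx A) (p : Y).
Hypothesis ap : chart_dom a p.
Variables (t : Y -> K) (B : Y -> 'M[K]_(n, k)).
Hypotheses (rt : regular_in a p t) (rB : entries_in (regular_in a p) B) (t0 : t p != 0).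

Lemma regular_in_inv_exp (d : nat) : regular_in a p (fun p' => t p' ^- d).
Proof. by apply: (regular_inV ap); [apply: fring_exp | apply: expf_neq0]. Qed.

Lemma regular_in_phi_val i : P (B p) i%:Z != 0 ->
  regular_in a p (fun p' => phi_val (t p') (B p') i).
Proof.
move=> P0; apply: fring_mul; first exact: regular_in_inv_exp.
by apply: (regular_in_div ap) => //; apply: fring_cyc_det rB.
Qed.

Lemma regular_in_eps_val i : P (B p) (i%:Z - 1) != 0 -> P (B p) (i%:Z + 1) != 0 ->
  regular_in a p (fun p' => eps_val (t p') (B p') i).
Proof.
move=> P1 P2; apply: fring_mul; first exact: regular_in_inv_exp.
apply: (regular_in_div ap); last exact: mulf_neq0.
  by apply: fring_mul; apply: fring_cyc_det rB.
by apply: fring_mul; apply: fring_cyc_det rB.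
Qed.

Lemma regular_in_gamma_val i : P (B p) (i%:Z - 1) != 0 ->
  regular_in a p (fun p' => gamma_val (t p') (B p') i).
Proof.
move=> P1; apply: fring_mul.
  by rewrite /gamma_weight; case: (1 <= i <= k)%N; [apply: fring_cst | apply: rt].
by apply: (regular_in_div ap) => //; apply: fring_cyc_det rB.
Qed.

Lemma regular_in_f_val : (forall m, P (B p) m != 0) ->
  regular_in a p (fun p' => f_val (t p') (B p')).
Proof.
move=> P0; apply: fring_sum => i _; apply: fring_mul; first exact: fring_exp.
by apply: (regular_in_div ap) => //; apply: fring_cyc_det rB.
Qed.

Lemma entries_in_e_mx (c : Y -> K) j : regular_in a p c -> N (B p) j != 0 ->
  entries_in (regular_in a p) (fun p' => e_mx (B p') j (c p')).
Proof.
move=> rc N0; apply: entries_in_mulmx => //; apply: entries_in_add; first exact: entries_in_cst.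
apply: entries_in_scale; last exact: entries_in_cst.
apply: fring_mul; first exact: fring_cst.
apply: (regular_in_div ap) => //; last exact: fring_cyc_det rB.
by apply: fring_mul; [apply: fring_sub => //; apply: fring_cst | apply: fring_cyc_det rB].
Qed.

End RegularValues.

Hypothesis K_infinite : infinite_type K.

Let X_variety : is_variety XA := Xk_variety K k' n.
Let X_irreducible : irreducible_space XA := Xk_irreducible K_infinite (ltnW k_lt_n).

Lemma generically_maxminor_neq0 (J : {set 'I_n}) : #|J| = k ->
  generically XA (fun x => maxminor (gr_mx x.1) J != 0).
Proof.
move=> cardJ; exists (fun x => maxminor (gr_mx x.1) J != 0); split=> //.
  exact: (zopen_fst (@Gr_dom_open K k' n J)).
by have [M MJ] := maxminor_neq0_exists K cardJ; exists (M, gm1 K).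
Qed.

Definition nondegenerate B : Prop := forall m, P B m != 0 /\ N B m != 0.

Lemma generically_nondegenerate :
  generically XA (fun x => exists2 B, spans x.1 B & nondegenerate B).
Proof.
have gP i : generically XA (fun x => P (gr_mx x.1) i%:Z != 0).
  apply: genericallyW (generically_maxminor_neq0 (card_row_set (window_increasing i%:Z))) => x.
  by rewrite (maxminor_row_set _ (window_increasing _)).
have gN i : generically XA (fun x => N (gr_mx x.1) i%:Z != 0).
  have := generically_maxminor_neq0 (card_row_set (raised_window_increasing i%:Z)).
  by apply: genericallyW => x; rewrite (maxminor_row_set _ (raised_window_increasing _)).
have := generically_and X_irreducible (generically_forall X_irreducible gP)
  (generically_forall X_irreducible gN).
apply: genericallyW => x [P0 N0]; exists (gr_mx x.1) => [|m]; first exact: spans_gr_mx.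
have mE : (n%:Z %| (ordz m)%:Z - m)%Z by rewrite dvdz_ord.
by rewrite -(window_minor_eqmod _ mE) -(raised_minor_eqmod _ mE).
Qed.

Lemma Xk_rational_to_Gm (F : X -> option (Gm K)) (v : K -> 'M[K]_(n, k) -> K) :
  (exists x g, F x = Some g) ->
  (forall J x g, maxminor (gr_mx x.1) J != 0 -> F x = Some g ->
     regular_in (Xk_chart K k' J) x (fun y => v (val y.2) (chart_mx J y.1)) /\
     near_in (Xk_chart K k' J) x (fun y => F y = to_Gm (v (val y.2) (chart_mx J y.1)))) ->
  is_rational XA (Gm_atlas K) F.
Proof.
move=> neF locF; apply: (is_rational_of_local X_variety (Gm_variety K)) => // -[J []] x g xJ Fx.
have [rv nF] := locF J x g xJ.1 Fx; apply: (rational_at_Gm xJ rv _ nF).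
by have := near_in_self xJ nF; rewrite Fx => /esym/to_GmP <-; apply: (valP g).
Qed.

Lemma nondegenerate_exists : exists x B, spans x.1 B /\ nondegenerate B.
Proof. by have [x [B sx ndB]] := generically_exists generically_nondegenerate; exists x, B. Qed.

Lemma Xphi_rational i : is_rational XA (Gm_atlas K) (Xphi (k := k) i).
Proof.
apply: (Xk_rational_to_Gm (v := fun t B => phi_val t B i)).
  have [x [B [sx ndB]]] := nondegenerate_exists; have [P0 N0] := ndB i%:Z.
  by have [g phix _] := Xphi_Some sx P0 N0; exists x, g.
move=> J x g xJ phix; have [P0 _] := Xphi_SomeP (spans_chart_mx xJ) phix; split.
  apply: regular_in_phi_val => //; last exact: (valP x.2).
  - exact: regular_in_Xk_scalar.
  - exact: entries_in_Xk_chart_mx.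
by apply: near_inT => y [yJ _]; apply: Xphi_spans; apply: spans_chart_mx.
Qed.

Lemma Xeps_rational i : is_rational XA (Gm_atlas K) (Xeps (k := k) i).
Proof.
apply: (Xk_rational_to_Gm (v := fun t B => eps_val t B i)).
  have [x [B [sx ndB]]] := nondegenerate_exists.
  by have [g epsx _] := Xeps_Some sx (fun m => (ndB m).1) (ndB i%:Z).2; exists x, g.
move=> J x g xJ; rewrite (Xeps_spans _ (spans_chart_mx xJ)) => /to_GmP gE; split.
  have := valP g; rewrite gE !mulf_eq0 !negb_or !invr_eq0 mulf_eq0 negb_or.
  move=> /and3P[_ _ /andP[P1 P2]].
  apply: regular_in_eps_val => //; last exact: (valP x.2).
  - exact: regular_in_Xk_scalar.
  - exact: entries_in_Xk_chart_mx.
by apply: near_inT => y [yJ _]; apply: Xeps_spans; apply: spans_chart_mx.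
Qed.

Lemma Xgamma_rational : is_rational XA (torus_atlas K n) (@Xgamma K n k).
Proof.
apply: (is_rational_of_local X_variety (torus_variety K n)).
  have [x [B [sx ndB]]] := nondegenerate_exists.
  by have [z gammax _] := Xgamma_Some sx (fun m => (ndB m).1); exists x, z.
move=> [J []] x z xJ gammax; have sx := spans_chart_mx xJ.1.
have gamma0 i : gamma_val (val x.2) (chart_mx J x.1) i != 0.
  move: gammax; rewrite (Xgamma_spans sx); case: insubP => // z' /forallP/(_ i).
  by rewrite mxE.
apply: (rational_at_torus xJ (h := fun y => \row_i gamma_val (val y.2) (chart_mx J y.1) i)) => //.
- move=> r i; have := gamma0 i; rewrite !mulf_eq0 !negb_or invr_eq0 => /and3P[_ _ P1].
  apply: fring_ext (regular_in_gamma_val (i := i) xJ (regular_in_Xk_scalar J x)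
    (entries_in_Xk_chart_mx J x) P1) => y.
  by rewrite mxE.
- by move=> i; rewrite mxE.
- by apply: near_inT => y [yJ _]; apply: Xgamma_spans; apply: spans_chart_mx.
Qed.

(* If [f] vanishes at [x], the decoration formula, whose proof does not use [f <> 0], shows that it
   does not vanish at [e_0^c x] for general [c]. *)
Lemma Xf_defined_somewhere : exists x g, Xf x = Some g :> option (Gm K).
Proof.
have [x [B [sx ndB]]] := nondegenerate_exists; have t0 := valP x.2.
have P0 m : P B m != 0 by case: (ndB m).
have [_ N0] := ndB (ord0 : 'I_n)%:Z; have [f0|f0] := eqVneq (f_val (val x.2) B) 0; last first.
  by have [g fx _] := to_Gm_Some f0; exists x, g; rewrite (Xf_spans sx P0).
have phi0 := phi_val_neq0 t0 (P0 _) N0; have eps0 := eps_val_neq0 t0 P0 N0.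
have f_e c (c0 : c != 0) := f_val_e_mx t0 P0 c0 N0.
move: phi0 eps0 f_e; move: (phi_val _ _ _) (eps_val _ _ _) => u v u0 v0 f_e.
have p0 : 'X * ('X - 1%:P) * ('X - (u / v)%:P) != 0 :> {poly K}.
  by rewrite !mulf_neq0 ?polyX_eq0 ?polyXsubC_eq0.
have [c] := poly_nonroot K_infinite p0; rewrite !hornerE !mulf_eq0 !negb_or -andbA.
move=> /and3P[c0 c1 cuv]; pose g : Gm K := exist _ c c0.
have [y _ [sy ty]] := Xe_Some g sx (P0 _) N0.
have fy0 : f_val (val y.2) (e_mx B (ord0 : 'I_n)%:Z c) != 0.
  rewrite ty f_e // f0 add0r (_ : _ + _ = (c - 1) * (c - u / v) / (c * u)).
    by rewrite !mulf_neq0 ?invr_eq0 ?mulf_neq0.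
  by field; rewrite c0 u0 v0.
have [w fy _] := to_Gm_Some fy0; exists y, w; rewrite (Xf_spans sy) //.
exact: window_minor_e_mx_neq0.
Qed.

Lemma Xf_rational : is_rational XA (Gm_atlas K) (@Xf K n k).
Proof.
apply: (Xk_rational_to_Gm (v := f_val)); first exact: Xf_defined_somewhere.
move=> J x g xJ fx; have [P0 _] := Xf_SomeP (spans_chart_mx xJ) fx.
have rB := @entries_in_Xk_chart_mx K k' n J x; split.
  by apply: regular_in_f_val => //; apply: regular_in_Xk_scalar.
have nP : near_in (Xk_chart K k' J) x (fun y => forall i, P (chart_mx J y.1) i%:Z != 0).
  apply: near_in_forall => i.
  by apply: (@regular_in_neq0 _ _ XA (Xk_chart K k' J)) => //; apply: fring_cyc_det rB.
apply: near_inW nP => y [yJ _] Py; apply: Xf_spans; first exact: spans_chart_mx.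
by move=> m; rewrite -window_minor_ordz.
Qed.

Lemma Xe_jointly_rational i :
  is_rational (prod_atlas (Gm_atlas K) XA) XA (fun gx => Xe i gx.1 gx.2).
Proof.
have varGX := prod_variety (Gm_variety K) X_variety.
apply: (is_rational_of_local varGX X_variety).
  have [x [B [sx ndB]]] := nondegenerate_exists; have [P0 N0] := ndB i%:Z.
  by have [y ex _] := Xe_Some (gm1 K) sx P0 N0; exists (gm1 K, x), y.
move=> [[] [J []]] [g x] y [_ [/= xJ _]] ex; have sx := spans_chart_mx xJ.
have [P0 N0 _ _] := Xe_SomeP sx ex;
pose a : chart_idx (prod_atlas (Gm_atlas K) XA) := (tt, Xk_chart K k' J).
have agx : chart_dom a (g, x) by [].
have rB : entries_in (regular_in a (g, x)) (fun gx => chart_mx J gx.2.1).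
  exact: (entries_in_snd _ (z := (g, x)) (@entries_in_Xk_chart_mx K k' n J x)).
have rt : regular_in a (g, x) (fun gx => val gx.2.2).
  exact: (regular_in_snd _ (z := (g, x)) (@regular_in_Xk_scalar K k' n J x)).
have rg : regular_in a (g, x) (fun gx => val gx.1).
  exact: (regular_in_fst _ (z := (g, x)) (regular_in_val_Gm g)).
apply: (rational_at_Xk agx (entries_in_e_mx agx rB rg N0) rt).
have nP := regular_in_neq0 agx (fring_cyc_det (window i%:Z) rB) P0.
have nN := regular_in_neq0 agx (fring_cyc_det (raised_window i%:Z) rB) N0.
apply: near_inW (near_inI nP nN) => -[h z] [_ [/= zJ _]] [Pz Nz].
exact: Xe_Some (spans_chart_mx zJ) Pz Nz.
Qed.

Lemma Xe_rational i g : is_rational XA XA (Xe (k := k) i g).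
Proof.
have [x [B [sx ndB]]] := nondegenerate_exists; have [P0 N0] := ndB i%:Z.
have [y ex _] := Xe_Some g sx P0 N0.
apply: (is_rational_comp (is_rational_pairr (Gm_variety K) X_variety g _) (Xe_jointly_rational i)).
  by exists x.
by exists x, y.
Qed.

(* [e_i^c] is dominant, with inverse [e_i^(1/c)]. *)
Lemma generically_Xe i g (U : X -> Prop) : generically XA U ->
  generically XA (fun x => exists2 y, Xe i g x = Some y & U y).
Proof.
apply: (generically_preim X_irreducible (Xe_rational i g)).
apply: genericallyW (rational_domain_generic (Xphi_rational i)) => x [v phix].
pose h : Gm K := exist _ (val g)^-1 (invr_neq0 (valP g)).
have := Xe_mul g h phix; have -> : gm_mul g h = gm1 K.
  by apply: val_inj; rewrite /= divff // (valP g).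
by rewrite (Xe_1 phix); case: (Xe i h x) => //= y ey; exists y.
Qed.

Lemma Xe_action i : rational_unital_action XA (Xe (k := k) i).
Proof.
have gphi := rational_domain_generic (Xphi_rational i); split.
- exact: Xe_jointly_rational.
- move=> x; exists Some; split=> //; first by apply: is_rational_id => //; exists x.
  by apply: genericallyW gphi => y [v /Xe_1]; exists y.
- move=> g1 g2; apply: genericallyW gphi => x [v phix].
  have [P0 N0] := Xphi_SomeP (spans_gr_mx x.1) phix.
  have [y ey _] := Xe_Some (gm_mul g1 g2) (spans_gr_mx x.1) P0 N0.
  by exists y; rewrite ?(Xe_mul g1 g2 phix).
Qed.

Lemma Xeps_Xphi_Xgamma x B i : spans x.1 B -> nondegenerate B ->
  exists u v z, [/\ Xeps i x = Some u, Xphi i x = Some v, Xgamma x = Some z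
    & val u = val v * alpha i z].
Proof.
move=> sx ndB; have P0 m : P B m != 0 by case: (ndB m).
have [_ N0] := ndB i%:Z; have [u epsx uE] := Xeps_Some sx P0 N0.
have [v phix vE] := Xphi_Some sx (P0 _) N0; have [z gammax zE] := Xgamma_Some sx P0.
by exists u, v, z; split=> //; rewrite uE vE /alpha !zE -eps_val_phi_val // (valP x.2).
Qed.

Lemma Xgamma_Xe x B i g : spans x.1 B -> nondegenerate B ->
  exists y z z', [/\ Xe i g x = Some y, Xgamma x = Some z, Xgamma y = Some z'
    & forall r, val z' 0 r = alpha_vee i g r * val z 0 r].
Proof.
move=> sx ndB; have P0 m : P B m != 0 by case: (ndB m).
have [_ N0] := ndB i%:Z; have [y ex [sy ty]] := Xe_Some g sx (P0 _) N0.
have [z gammax zE] := Xgamma_Some sx P0.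
have [z' gammay z'E] := Xgamma_Some sy (window_minor_e_mx_neq0 (valP g) N0 P0).
by exists y, z, z'; split=> // r; rewrite zE z'E ty (gamma_val_e_mx _ P0 (valP g) N0 _ erefl).
Qed.

Lemma Xphi_Xe x B i g : spans x.1 B -> nondegenerate B ->
  exists y v v', [/\ Xe i g x = Some y, Xphi i x = Some v, Xphi i y = Some v'
    & val v' = (val g)^-1 * val v].
Proof.
move=> sx ndB; have [P0 N0] := ndB i%:Z; have [y ex [sy ty]] := Xe_Some g sx P0 N0.
have [v phix vE] := Xphi_Some sx P0 N0.
have [||v' phiy v'E] := Xphi_Some (i := i) sy.
- by rewrite window_minor_e_mx // mulf_neq0 // (valP g).
- by rewrite raised_minor_e_mx.
by exists y, v, v'; split=> //; rewrite v'E vE ty phi_val_e_mx.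
Qed.

Lemma Xeps_Xe x B i g : spans x.1 B -> nondegenerate B ->
  exists y u u', [/\ Xe i g x = Some y, Xeps i x = Some u, Xeps i y = Some u'
    & val u' = val g * val u].
Proof.
move=> sx ndB; have P0 m : P B m != 0 by case: (ndB m).
have [_ N0] := ndB i%:Z; have [y ex [sy ty]] := Xe_Some g sx (P0 _) N0.
have [u epsx uE] := Xeps_Some sx P0 N0.
have [|u' epsy u'E] := Xeps_Some (i := i) sy (window_minor_e_mx_neq0 (valP g) N0 P0).
  by rewrite raised_minor_e_mx.
by exists y, u, u'; split=> //; rewrite u'E uE ty eps_val_e_mx.
Qed.

Lemma Xf_Xe x B i g y z z' : spans x.1 B -> nondegenerate B ->
  Xe i g x = Some y -> Xf x = Some z -> Xf y = Some z' ->
  exists u v, [/\ Xeps i x = Some u, Xphi i x = Some v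
    & val z' = val z + (val g - 1) / val v + ((val g)^-1 - 1) / val u].
Proof.
move=> sx ndB ex fx fy; have P0 m : P B m != 0 by case: (ndB m).
have [_ N0 sy ty] := Xe_SomeP sx ex; have [u epsx uE] := Xeps_Some sx P0 N0.
have [v phix vE] := Xphi_Some sx (P0 _) N0; exists u, v; split=> //.
have [_ ->] := Xf_SomeP sx fx; have [_ ->] := Xf_SomeP sy fy.
by rewrite ty uE vE f_val_e_mx // ?(valP x.2) // (valP g).
Qed.

Lemma Xe_comm i r g h : i != r -> ~~ adjacent i r ->
  Defs.rat_eq XA (fun x => obind (Xe i g) (Xe r h x)) (fun x => obind (Xe r h) (Xe i g x)).
Proof.
rewrite /adjacent negb_or => ir /andP[rSi iSr].
have ri : r != i by rewrite eq_sym.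
have dvd_ir : ~~ (n%:Z %| r%:Z - i%:Z)%Z by rewrite dvdz_ord ordz_ord.
have dvd_ri : ~~ (n%:Z %| i%:Z - r%:Z)%Z by rewrite dvdz_ord ordz_ord.
have dvd_Sir : ~~ (n%:Z %| i%:Z + 1 - r%:Z)%Z by rewrite -ordz_eq ordzS !ordz_ord eq_sym.
have dvd_Sri : ~~ (n%:Z %| r%:Z + 1 - i%:Z)%Z by rewrite -ordz_eq ordzS !ordz_ord eq_sym.
apply: genericallyW generically_nondegenerate => x [B sx ndB].
have [[Pi Ni] [Pr Nr]] := (ndB i%:Z, ndB r%:Z).
have [y ey [sy ty]] := Xe_Some g sx Pi Ni; have [z ez [sz tz]] := Xe_Some h sx Pr Nr.
have [||y' ey' [sy' ty']] := Xe_Some (i := r) h sy.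
- by rewrite window_minor_e_mx_other.
- by rewrite [N _ _]raised_minor_xmx_other.
have [||z' ez' [sz' tz']] := Xe_Some (i := i) g sz.
- by rewrite window_minor_e_mx_other.
- by rewrite [N _ _]raised_minor_xmx_other.
exists y'; rewrite ?ey ?ez /= ?ez' //; congr Some.
by rewrite e_mx_comm // in sz'; apply: Xk_eq sz' sy' _; rewrite tz' tz ty' ty.
Qed.

Lemma Xe_braid i g h (r := ordS i) : (2 < n)%N ->
  Defs.rat_eq XA
    (fun x => obind (Xe i g) (obind (Xe r (gm_mul g h)) (Xe i h x)))
    (fun x => obind (Xe r h) (obind (Xe i (gm_mul g h)) (Xe r g x))).
Proof.
move=> n2; have defXe s d := rational_domain_generic (Xe_rational s d).
have gl := generically_Xe i h (generically_Xe r (gm_mul g h) (defXe i g)).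
have gr := generically_Xe r g (generically_Xe i (gm_mul g h) (defXe r h)).
apply: genericallyW (generically_and X_irreducible gl gr) => x.
move=> [[x1 e1 [x2 e2 [x3 e3]]] [y1 d1 [y2 d2 [y3 d3]]]].
have eqmod_r B c : e_mx B r%:Z c = e_mx B (i%:Z + 1) c by apply: e_mx_eqmod; apply: dvdz_ordS.
have NE B : N B r%:Z = N B (i%:Z + 1) by apply: raised_minor_eqmod; apply: dvdz_ordS.
have sx := spans_gr_mx x.1; move: (gr_mx x.1) sx => B sx.
have [Pi Ni s1 t1] := Xe_SomeP sx e1; have [_ N1 s2 t2] := Xe_SomeP s1 e2.
have [_ N2 s3 t3] := Xe_SomeP s2 e3; have [_ Nr q1 r1] := Xe_SomeP sx d1.
have [_ M1 q2 r2] := Xe_SomeP q1 d2; have [_ M2 q3 r3] := Xe_SomeP q2 d3.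
rewrite !eqmod_r ?NE in N1 N2 Nr M1 M2 s3 q3.
exists x3; first by rewrite e1 /= e2 /= e3.
rewrite d1 /= d2 /= d3; congr Some; rewrite -e_mx_braid ?(valP g) ?(valP h) // in q3.
by apply: Xk_eq q3 s3 _; rewrite r3 r2 r1 t3 t2 t1.
Qed.

Lemma Xk_precrystal : geometric_precrystal XA
  (@Xgamma K n k) (@Xphi K n k) (@Xeps K n k) (@Xe K n k).
Proof.
split=> //.
- exact: Xgamma_rational.
- exact: Xphi_rational.
- exact: Xeps_rational.
- exact: Xe_action.
- by move=> i; apply: genericallyW generically_nondegenerate => x [B]; apply: Xeps_Xphi_Xgamma.
- by move=> i g; apply: genericallyW generically_nondegenerate => x [B]; apply: Xgamma_Xe.
- by move=> i g; apply: genericallyW generically_nondegenerate => x [B]; apply: Xphi_Xe.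
- by move=> i g; apply: genericallyW generically_nondegenerate => x [B]; apply: Xeps_Xe.
Qed.

Lemma Xk_crystal : geometric_crystal XA
  (@Xgamma K n k) (@Xphi K n k) (@Xeps K n k) (@Xe K n k).
Proof.
split=> [|_ i r g h|n2 i r g h /orP[/eqP->|/eqP->]]; first exact: Xk_precrystal.
- exact: Xe_comm.
- exact: Xe_braid.
- have -> : gm_mul g h = gm_mul h g by apply: val_inj; rewrite /= mulrC.
  by apply: rat_eq_sym; apply: Xe_braid.
Qed.

Lemma Xk_decorated_crystal : decorated_geometric_crystal XA
  (@Xgamma K n k) (@Xphi K n k) (@Xeps K n k) (@Xe K n k) (@Xf K n k).
Proof.
have f_defined := rational_domain_generic Xf_rational.
split=> [||i g]; [exact: Xk_crystal | exact: Xf_rational |].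
apply: genericallyW (generically_and X_irreducible generically_nondegenerate
  (generically_and X_irreducible f_defined (generically_Xe i g f_defined))).
move=> x [[B sx ndB] [[w fx] [y ex [w' fy]]]].
by have [u [v [epsx phix fE]]] := Xf_Xe sx ndB ex fx fy; exists y, u, v, w, w'.
Qed.

End CyclicMinors.

Theorem theorem3p8 (R : realType) (n k : nat)
    (hn : (2 <= n)%N) (hk : (1 <= k <= n - 1)%N) :
  decorated_geometric_crystal
    (@Xk_atlas (complex R) n k)
    (@Xgamma (complex R) n k)
    (@Xphi (complex R) n k)
    (@Xeps (complex R) n k)
    (@Xe (complex R) n k)
    (@Xf (complex R) n k).
Proof.
case: n hn hk => // n' _; case: k => // k' k_le.
have k_lt_n : (k'.+1 < n'.+1)%N by lia.
apply: (Xk_decorated_crystal k_lt_n); exists (fun m => m%:R) => a b /eqP.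
by rewrite eqr_nat => /eqP.
Qed.
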